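(* Let $D$ be an Arakelov divisor on $\overline{\mathrm{Spec}\,\mathbb Z}$. Then $$\dim_{\mathbb S[\pm1]}H^0(D)-\dim_{\mathbb S[\pm1]}H^1(D)=\bigl\lceil \deg' D+\log' 2\bigr\rceil'-\mathbf 1_L(\deg' D),$$ where $\log' x:=\log x/\log 3$, $\deg' D:=\deg D/\log 3$, $\lceil\cdot\rceil'$ is the odd function on $\mathbb R$ that agrees with the ceiling function on positive reals ($\lceil x\rceil'=\lceil x\rceil$ for $x\ge 0$, $\lceil x\rceil'=-\lceil -x\rceil$ for $x\le 0$), and $\mathbf 1_L$ is the characteristic function of the set of finite Lebesgue measure $$L=\bigcup_{k\ge 0}\Bigl(\log'\tfrac{3^k}{2},\ \log'\tfrac{3^k+1}{2}\Bigr).$$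
   Context: Arakelov divisors. An Arakelov divisor on $\overline{\mathrm{Spec}\,\mathbb Z}$ is a formal finite sum $D=\sum_j a_j\{p_j\}+a\{\infty\}$ with $p_j$ distinct rational primes, $a_j\in\mathbb Z$, $a\in\mathbb R$; $\deg D=\sum_j a_j\log p_j+a$ (natural logarithm). Let $\mathbb A_{\mathbb Q}$ be the adeles of $\mathbb Q$, $\mathbb Q\subset\mathbb A_{\mathbb Q}$ diagonally. Put $\mathcal O(D)_f=\prod_p \mathcal O(D)_p$ (product over all primes) with $\mathcal O(D)_{p_j}=p_j^{-a_j}\mathbb Z_{p_j}$ and $\mathcal O(D)_p=\mathbb Z_p$ for the other primes. $\mathbb S$-modules. $\Gamma^{o}$ is the category with objects the pointed sets $k_+=\{0,1,\dots,k\}$ (base point $*=0$), $k\in\mathbb N$, and all pointed maps. An $\mathbb S$-module is a functor $\Gamma^{o}\to$ pointed sets sending $0_+$ to a point. An $\mathbb S[\pm1]$-module is an $\mathbb S$-module $E$ with an action of the group $\{\pm1\}$ by automorphisms of $E$; for $x\in E(1_+)$ one sets $0\cdot x=*$. For an abelian group $A$, $HA$ is the $\mathbb S[\pm1]$-module with $HA(k_+)=A^{k}$ (base point $0$), where a pointed map $\phi:k_+\to\ell_+$ acts by $(HA(\phi)(x))_j=\sum_{i:\phi(i)=j}x_i$ for $1\le j\le\ell$, and $\pm1$ acts by $x\mapsto\pm x$. A tolerance relation is a reflexive and symmetric relation. A tolerant $\mathbb S[\pm1]$-module $(E,\mathcal R)$ is an $\mathbb S[\pm1]$-module $E$ with a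 tolerance relation $\mathcal R_k$ on each $E(k_+)$ preserved by all maps $E(\phi)$ and by $\pm1$; an $\mathbb S[\pm1]$-module without specified relation is given the diagonal relations. Cohomologies. $H^0(D)$ is the kernel of $(q,a)\mapsto q+a$ on $H\mathbb Q\times H\mathcal O(D)$, where $H\mathcal O(D)(k_+)\subset \mathbb A_{\mathbb Q}^{k}$ consists of the $k$-tuples $(b_1,\dots,b_k)$ of adeles whose finite parts lie in $\mathcal O(D)_f$ and whose archimedean components satisfy $\sum_i|b_{i,\infty}|\le e^a$. Explicitly $H^0(D)(k_+)=\{(q_1,\dots,q_k)\in\mathbb Q^k\mid q_i\in\mathcal O(D)_f\ \forall i,\ \sum_i|q_i|\le e^a\}$, a sub-$\mathbb S[\pm1]$-module of $H\mathbb Q$. $H^1(D)$ is the tolerant $\mathbb S[\pm1]$-module $(H\mathbb A_{\mathbb Q},\mathcal R)$ with $(x,y)\in\mathcal R_k$ if and only if $x-y=q+b$ for some $q\in\mathbb Q^k$, $b\in H\mathcal O(D)(k_+)$. Dimension. Let $\sigma:k_+\to1_+$ be the map with $\sigma(\ell)=1$ for all $\ell\ne *$, and $\delta(j,k):k_+\to1_+$ the map sending $j$ to $1$ and all else to $*$. For $x,x_1,\dots,x_k\in E(1_+)$ one writes $x=\sum_j x_j$ if there is $z\in E(k_+)$ with $E(\sigma)(z)=x$ and $E(\delta(j,k))(z)=x_j$ for all $j$ (the empty sum is $*$). For a tolerant $\mathbb S[\pm1]$-module $(E,\mathcal R)$, a finite subset $F\subset E(1_+)$ is generating if (1) $(x,y)\notin\mathcal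 R_1$ for all $x\ne y$ in $F$; (2) for every $x\in E(1_+)$ there are $\alpha_j\in\{-1,0,1\}$, $j\in F$, and $y\in E(1_+)$ with $y=\sum_{j\in F}\alpha_j j$, meaning that, writing $F=\{f_1,\dots,f_k\}$ with $k=\#F$, there is $z\in E(k_+)$ with $E(\sigma)(z)=y$ and $E(\delta(i,k))(z)=\alpha_{f_i}f_i$ for all $1\le i\le k$ (and $y=*$ if $F=\emptyset$), and $(x,y)\in\mathcal R_1$. $\dim_{\mathbb S[\pm1]}(E,\mathcal R)$ is the minimal cardinality of a generating set. *)

(* Defs.v *)
From HB Require Import structures.
From mathcomp Require Import all_boot all_order all_algebra.
From mathcomp Require Import finmap all_classical all_reals all_analysis.

Set Implicit Arguments.
Unset Strict Implicit.
Unset Printing Implicit Defensive.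

Import Order.TTheory GRing.Theory Num.Theory.

Local Open Scope classical_set_scope.
Local Open Scope quotient_scope.
Local Open Scope ring_scope.

Definition prime_number := {p : nat | prime p}.

Section PadicAbs.
Variable p : prime_number.
Implicit Types x y : rat.

Definition padic_val x : int :=
  (logn (val p) `|numq x|)%:Z - (logn (val p) `|denq x|)%:Z.

Definition padic_abs x : rat :=
  if x == 0 then 0 else (val p)%:R ^ (- padic_val x).

Lemma prime_gt0q : 0 < (val p)%:R :> rat.
Proof. by rewrite ltr0n prime_gt0 ?(valP p). Qed.

Lemma prime_gt1q : 1 < (val p)%:R :> rat.
Proof. by rewrite ltr1n prime_gt1 ?(valP p). Qed.

Lemma padic_val_frac (n d : int) : n != 0 -> d != 0 ->
  padic_val (n%:~R / d%:~R) = (logn (val p) `|n|)%:Z - (logn (val p) `|d|)%:Z.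
Proof.
move=> n0 d0; set x := _ / _.
have x0 : x != 0 by rewrite mulf_neq0 ?invr_eq0 ?intr_eq0.
have E : numq x * d = n * denq x.
  apply: (@intr_inj rat); rewrite !rmorphM /=.
  have dx : (denq x)%:~R != 0 :> rat by rewrite intr_eq0 denq_neq0.
  have d0' : d%:~R != 0 :> rat by rewrite intr_eq0.
  apply: (mulIf (invr_neq0 d0')); rewrite mulfK // mulrAC -/x.
  by rewrite numqE.
have /(congr1 (logn (val p))) := congr1 absz E.
rewrite !abszM !lognM ?absz_gt0 ?numq_eq0 ?denq_neq0 // => /(congr1 Posz).
rewrite !PoszD /padic_val => {}E.
by apply/eqP; rewrite subr_eq addrAC -subr_eq opprK E.
Qed.

Lemma padic_abs0 : padic_abs 0 = 0. Proof. by rewrite /padic_abs eqxx. Qed.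

Lemma padic_abs_ge0 x : 0 <= padic_abs x.
Proof. by rewrite /padic_abs; case: ifP => // _; rewrite exprz_ge0 ?ltW ?prime_gt0q. Qed.

Lemma padic_absM x y : padic_abs (x * y) = padic_abs x * padic_abs y.
Proof.
rewrite /padic_abs mulf_eq0.
have [->|x0] /= := eqVneq x 0; first by rewrite mul0r.
have [_|y0] /= := eqVneq y 0; first by rewrite mulr0.
rewrite -expfzDr ?gt_eqF ?prime_gt0q // -opprD; congr (_ ^ (- _)).
have -> : x * y = (numq x * numq y)%:~R / (denq x * denq y)%:~R.
  by rewrite !rmorphM /= -mulf_div !divq_num_den.
rewrite padic_val_frac ?mulf_neq0 ?numq_eq0 ?denq_neq0 //.
by rewrite !abszM !lognM ?absz_gt0 ?numq_eq0 ?denq_neq0 // !PoszD opprD addrACA.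
Qed.

Lemma padic_absN x : padic_abs (- x) = padic_abs x.
Proof. by rewrite /padic_abs oppr_eq0 /padic_val numqN denqN abszN. Qed.

Lemma padic_abs1 : padic_abs 1 = 1.
Proof. by rewrite /padic_abs oner_eq0 /padic_val /= logn1. Qed.

Lemma padic_abs_int (n : int) : padic_abs n%:~R <= 1.
Proof.
rewrite /padic_abs; case: ifP => // _; rewrite /padic_val.
rewrite numq_int denq_int logn1 subr0.
by rewrite -exprz_inv exprn_ile1 ?invr_ge0 ?invf_le1 ?ltW ?prime_gt0q ?prime_gt1q.
Qed.

Lemma padic_absD x y :
  padic_abs (x + y) <= Num.max (padic_abs x) (padic_abs y).
Proof.
have [->|x0] := eqVneq x 0; first by rewrite add0r le_max lexx orbT.
have [->|y0] := eqVneq y 0; first by rewrite addr0 le_max lexx.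
have [->|xy0] := eqVneq (x + y) 0.
  by rewrite padic_abs0 le_max padic_abs_ge0.
suff : (padic_val x <= padic_val (x + y)) || (padic_val y <= padic_val (x + y)).
  rewrite le_max /padic_abs !ifF; try exact/negbTE.
  by rewrite !ler_eXz2l ?prime_gt1q // !lerN2.
pose a := numq x * denq y; pose b := numq y * denq x.
pose d := denq x * denq y.
have d0 : d != 0 by rewrite mulf_neq0 ?denq_neq0.
have dx : (denq x)%:~R != 0 :> rat by rewrite intr_eq0 denq_neq0.
have dy : (denq y)%:~R != 0 :> rat by rewrite intr_eq0 denq_neq0.
have Ex : x = a%:~R / d%:~R.
  by rewrite !rmorphM /= -mulf_div divff // mulr1 divq_num_den.
have Ey : y = b%:~R / d%:~R.
  rewrite !rmorphM /= [(denq x)%:~R * (denq y)%:~R]mulrC -mulf_div divff //.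
  by rewrite mulr1 divq_num_den.
have Exy : x + y = (a + b)%:~R / d%:~R by rewrite {1}Ex {1}Ey -mulrDl -rmorphD.
have a0 : a != 0 by rewrite mulf_neq0 ?numq_eq0 ?denq_neq0.
have b0 : b != 0 by rewrite mulf_neq0 ?numq_eq0 ?denq_neq0.
have ab0 : a + b != 0.
  by apply: contra_neq xy0 => ab0; rewrite Exy ab0 mul0r.
rewrite Exy {1}Ex {1}Ey !padic_val_frac // !lerD2r !lez_nat.
set m := minn (logn (val p) `|a|) (logn (val p) `|b|).
have pdv (c : int) : c != 0 ->
    ((val p ^ m)%:Z %| c)%Z = (m <= logn (val p) `|c|)%N.
  by move=> c0; rewrite dvdzE /= pfactor_dvdn ?(valP p) ?absz_gt0.
have : ((val p ^ m)%:Z %| a + b)%Z.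
  by apply: rpredD; rewrite pdv // ?geq_minl ?geq_minr.
by rewrite pdv // geq_min.
Qed.

Lemma padic_absB x y :
  padic_abs (x - y) <= Num.max (padic_abs x) (padic_abs y).
Proof. by rewrite -(padic_absN y) padic_absD. Qed.

Implicit Types u v : nat -> rat.

Definition padic_cauchy u : Prop :=
  forall e : rat, 0 < e -> exists N : nat, forall m n : nat,
    (N <= m)%N -> (N <= n)%N -> padic_abs (u m - u n) < e.

Definition padic_null u : Prop :=
  forall e : rat, 0 < e -> exists N : nat, forall n : nat,
    (N <= n)%N -> padic_abs (u n) < e.

Definition cauchy_pred : {pred nat -> rat} := fun u => `[< padic_cauchy u >].

Lemma const_cauchy x : padic_cauchy (fun=> x).
Proof. by move=> e e0; exists 0%N => m n _ _; rewrite subrr padic_abs0. Qed.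

Lemma cauchy_bounded u : padic_cauchy u ->
  exists2 B : rat, 0 < B & exists N : nat, forall n, (N <= n)%N -> padic_abs (u n) <= B.
Proof.
move=> /(_ 1 ltr01)[N hN]; exists (Num.max 1 (padic_abs (u N))).
  by rewrite lt_max ltr01.
exists N => n Nn; rewrite -[u n](subrK (u N)).
apply: le_trans (padic_absD _ _) _.
by rewrite ge_max !le_max lexx orbT (ltW (hN _ _ _ _)).
Qed.

Lemma cauchy_subring : GRing.subring_closed cauchy_pred.
Proof.
split.
- apply/asboolP => e e0; exists 0%N => m n _ _.
  by rewrite /GRing.one /= subrr padic_abs0.
- move=> u v /asboolP cu /asboolP cv; apply/asboolP => e e0.
  have [[N hN] [M hM]] := (cu e e0, cv e e0).
  exists (maxn N M) => m n; rewrite !geq_max => /andP[Nm Mm] /andP[Nn Mn].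
  have -> : (u - v) m - (u - v) n = (u m - u n) - (v m - v n).
    rewrite -[LHS]/(u m - v m - (u n - v n)) !opprB.
    by rewrite [v n - u n]addrC addrACA [- v m + _]addrC.
  by apply: le_lt_trans (padic_absB _ _) _; rewrite gt_max hN ?hM.
- move=> u v /asboolP cu /asboolP cv; apply/asboolP => e e0.
  have [B B0 [N1 hN1]] := cauchy_bounded cu.
  have [C C0 [N2 hN2]] := cauchy_bounded cv.
  have [N3 hN3] := cu _ (divr_gt0 e0 C0).
  have [N4 hN4] := cv _ (divr_gt0 e0 B0).
  exists (maxn (maxn N1 N2) (maxn N3 N4)) => m n; rewrite !geq_max.
  move=> /andP[/andP[m1 m2] /andP[m3 m4]] /andP[/andP[n1 n2] /andP[n3 n4]].
  have -> : (u * v) m - (u * v) n = u m * (v m - v n) + (u m - u n) * v n.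
    by rewrite mulrBr mulrBl addrA subrK.
  apply: le_lt_trans (padic_absD _ _) _; rewrite gt_max !padic_absM.
  apply/andP; split.
    apply: le_lt_trans (ler_wpM2r (padic_abs_ge0 _) (hN1 _ m1)) _.
    by rewrite mulrC -ltr_pdivlMr ?hN4.
  apply: le_lt_trans (ler_wpM2l (padic_abs_ge0 _) (hN2 _ n2)) _.
  by rewrite -ltr_pdivlMr ?hN3.
Qed.

HB.instance Definition _ :=
  GRing.isSubringClosed.Build (nat -> rat) cauchy_pred cauchy_subring.

Record padic_cauchy_seq := PadicCauchySeq {
  cauchy_val :> nat -> rat;
  cauchy_valP : cauchy_val \in cauchy_pred }.

HB.instance Definition _ := [isSub for cauchy_val].
HB.instance Definition _ := [Choice of padic_cauchy_seq by <:].
HB.instance Definition _ :=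
  [SubChoice_isSubComNzRing of padic_cauchy_seq by <:].

Definition null_pred : {pred padic_cauchy_seq} :=
  fun s => `[< padic_null s >].

Lemma null_ideal : idealr_closed null_pred.
Proof.
split.
- by apply/asboolP => e e0; exists 0%N => n _; rewrite padic_abs0.
- apply/negP => /asboolP /(_ 1 ltr01)[N /(_ N (leqnn N))].
  by rewrite padic_abs1 ltxx.
- move=> a s t /asboolP nu /asboolP nv; apply/asboolP => e e0.
  have [B B0 [N1 hN1]] := cauchy_bounded (asboolW (cauchy_valP a)).
  have [N2 hN2] := nu _ (divr_gt0 e0 B0).
  have [N3 hN3] := nv _ e0.
  exists (maxn N1 (maxn N2 N3)) => n; rewrite !geq_max => /and3P[n1 n2 n3].
  apply: le_lt_trans (padic_absD _ _) _; rewrite gt_max hN3 // andbT.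
  rewrite padic_absM; apply: le_lt_trans (ler_wpM2r (padic_abs_ge0 _) (hN1 _ n1)) _.
  by rewrite mulrC -ltr_pdivlMr ?hN2.
Qed.

HB.instance Definition _ := isIdealr.Build padic_cauchy_seq null_pred null_ideal.

Definition Qp := {ideal_quot null_pred}.
HB.instance Definition _ := GRing.ComNzRing.on Qp.

End PadicAbs.

Definition const_seq (p : prime_number) (x : rat) : padic_cauchy_seq p :=
  PadicCauchySeq (asboolT (const_cauchy p x)).

Definition rat_Qp (p : prime_number) (x : rat) : Qp p := \pi_(Qp p) (const_seq p x).

Lemma rat_Qp_is_zmod_morphism p : zmod_morphism (rat_Qp p).
Proof. by move=> x y; rewrite /rat_Qp -rmorphB; congr (\pi_(Qp p) _); exact: val_inj. Qed.

Lemma rat_Qp_is_monoid_morphism p : monoid_morphism (rat_Qp p).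
Proof.
split; first by rewrite /rat_Qp -(rmorph1 \pi_(Qp p)); congr (\pi_(Qp p) _); exact: val_inj.
by move=> x y; rewrite /rat_Qp -rmorphM; congr (\pi_(Qp p) _); exact: val_inj.
Qed.

HB.instance Definition _ p :=
  GRing.isZmodMorphism.Build rat (Qp p) (rat_Qp p) (rat_Qp_is_zmod_morphism p).
HB.instance Definition _ p :=
  GRing.isMonoidMorphism.Build rat (Qp p) (rat_Qp p)
    (rat_Qp_is_monoid_morphism p).

(* The closed unit ball of Q_p: limits of sequences of rationals of p-adic
   absolute value at most 1. *)
Definition Zpadic (p : prime_number) : set (Qp p) :=
  [set x | exists2 u : padic_cauchy_seq p,
     forall n, padic_abs p (u n) <= 1 & x = \pi_(Qp p) u].
Arguments Zpadic : clear implicits.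

Lemma ZpB p x y : Zpadic p x -> Zpadic p y -> Zpadic p (x - y).
Proof.
move=> [u hu ->] [v hv ->]; exists (u - v); last by rewrite rmorphB.
by move=> n; apply: le_trans (padic_absB _ _ _) _; rewrite ge_max hu hv.
Qed.

Lemma ZpM p x y : Zpadic p x -> Zpadic p y -> Zpadic p (x * y).
Proof.
move=> [u hu ->] [v hv ->]; exists (u * v); last by rewrite rmorphM.
by move=> n; rewrite padic_absM mulr_ile1 ?padic_abs_ge0 ?hu ?hv.
Qed.

Lemma Zp_rat p x : padic_abs p x <= 1 -> Zpadic p (rat_Qp p x).
Proof. by move=> x1; exists (const_seq p x). Qed.

Lemma Zp1 p : Zpadic p 1.
Proof. by rewrite -(rmorph1 (rat_Qp p)); apply: Zp_rat; rewrite padic_abs1. Qed.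

Lemma Zp0 p : Zpadic p 0.
Proof. by rewrite -(subrr 1); apply: ZpB; exact: Zp1. Qed.

Lemma ZpN p x : Zpadic p x -> Zpadic p (- x).
Proof. by rewrite -sub0r; apply: ZpB; exact: Zp0. Qed.

Lemma ZpD p x y : Zpadic p x -> Zpadic p y -> Zpadic p (x + y).
Proof. by move=> hx hy; rewrite -[y]opprK; apply/ZpB/ZpN. Qed.

Section Adele.
Variable R : realType.

Record adele := Adele {
  arch : R;
  fin_part : forall p : prime_number, Qp p;
  adele_integral : finite_set [set p | ~ Zpadic p (fin_part p)] }.

HB.instance Definition _ := gen_eqMixin adele.
HB.instance Definition _ := gen_choiceMixin adele.

Lemma adele_eq (x y : adele) :
  arch x = arch y -> (forall p, fin_part x p = fin_part y p) -> x = y.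
Proof.
case: x y => [a f hf] [b g hg] /= -> fg.
have {}fg : f = g by exact: functional_extensionality_dep.
by case: g / fg hg => hg; congr Adele; exact: Prop_irrelevance.
Qed.

Lemma bad_op1 (op : forall p, Qp p -> Qp p) (x : adele) :
    (forall p a, Zpadic p a -> Zpadic p (op p a)) ->
  finite_set [set p | ~ Zpadic p (op p (fin_part x p))].
Proof.
move=> h; apply: sub_finite_set (adele_integral x) => p /= hp /h; exact: hp.
Qed.

Lemma bad_op2 (op : forall p, Qp p -> Qp p -> Qp p) (x y : adele) :
    (forall p a b, Zpadic p a -> Zpadic p b -> Zpadic p (op p a b)) ->
  finite_set [set p | ~ Zpadic p (op p (fin_part x p) (fin_part y p))].
Proof.
move=> h.
have /sub_finite_set : [set p | ~ Zpadic p (op p (fin_part x p) (fin_part y p))] `<=`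
    [set p | ~ Zpadic p (fin_part x p)] `|` [set p | ~ Zpadic p (fin_part y p)].
  move=> p /= hp; have [hx|] := pselect (Zpadic p (fin_part x p)); last by left.
  by right => hy; apply: hp; exact: h.
by apply; rewrite finite_setU; split; exact: adele_integral.
Qed.

Lemma bad_cst (c : forall p, Qp p) : (forall p, Zpadic p (c p)) ->
  finite_set [set p | ~ Zpadic p (c p)].
Proof. by move=> h; apply: sub_finite_set (@finite_set0 _) => p /=; apply. Qed.

Definition adele0 := Adele 0 (bad_cst Zp0).
Definition adele1 := Adele 1 (bad_cst Zp1).
Definition adele_opp x := Adele (- arch x) (bad_op1 x ZpN).
Definition adele_add x y := Adele (arch x + arch y) (bad_op2 x y ZpD).
Definition adele_mul x y := Adele (arch x * arch y) (bad_op2 x y ZpM).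

Lemma adele_addA : associative adele_add.
Proof. by move=> x y z; apply: adele_eq => [|p] /=; rewrite addrA. Qed.
Lemma adele_addC : commutative adele_add.
Proof. by move=> x y; apply: adele_eq => [|p] /=; rewrite addrC. Qed.
Lemma adele_add0 : left_id adele0 adele_add.
Proof. by move=> x; apply: adele_eq => [|p] /=; rewrite add0r. Qed.
Lemma adele_addN : left_inverse adele0 adele_opp adele_add.
Proof. by move=> x; apply: adele_eq => [|p] /=; rewrite addNr. Qed.

HB.instance Definition _ := GRing.isZmodule.Build adele
  adele_addA adele_addC adele_add0 adele_addN.

Lemma adele_mulA : associative adele_mul.
Proof. by move=> x y z; apply: adele_eq => [|p] /=; rewrite mulrA. Qed.
Lemma adele_mulC : commutative adele_mul.
Proof. by move=> x y; apply: adele_eq => [|p] /=; rewrite mulrC. Qed.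
Lemma adele_mul1 : left_id adele1 adele_mul.
Proof. by move=> x; apply: adele_eq => [|p] /=; rewrite mul1r. Qed.
Lemma adele_mulD : left_distributive adele_mul +%R.
Proof. by move=> x y z; apply: adele_eq => [|p] /=; rewrite mulrDl. Qed.
Lemma adele_1neq0 : adele1 != 0.
Proof. by apply/eqP => /(congr1 arch) /eqP /=; rewrite oner_eq0. Qed.

HB.instance Definition _ := GRing.Zmodule_isComNzRing.Build adele
  adele_mulA adele_mulC adele_mul1 adele_mulD adele_1neq0.

Lemma arch_is_zmod_morphism : zmod_morphism arch. Proof. by []. Qed.
HB.instance Definition _ :=
  GRing.isZmodMorphism.Build adele R arch arch_is_zmod_morphism.

Lemma bad_rat (x : rat) : finite_set [set p | ~ Zpadic p (rat_Qp p x)].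
Proof.
have /sub_finite_set : [set p | ~ Zpadic p (rat_Qp p x)] `<=`
    val @^-1` [set n : nat | (n < `|denq x|.+1)%N].
  move=> p /= hp; rewrite ltnS; apply/dvdn_leq; first by rewrite absz_gt0 denq_neq0.
  apply: contrapT => /negP pNd; apply: hp; apply: Zp_rat.
  rewrite /padic_abs; case: ifP => // _; rewrite /padic_val.
  rewrite [X in _ - X%:Z](_ : _ = 0%N) ?subr0; last first.
    by apply/eqP; rewrite -leqn0 leqNgt logn_gt0 mem_primes (negPf pNd) !andbF.
  rewrite -exprz_inv exprn_ile1 ?invr_ge0 ?invf_le1 ?ltW ?prime_gt0q //.
  exact: prime_gt1q.
apply; apply: finite_preimage; last exact: finite_II.
by move=> a b _ _; exact: val_inj.
Qed.

Definition diag (x : rat) : adele := Adele (ratr x) (bad_rat x).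

Lemma diag_is_zmod_morphism : zmod_morphism diag.
Proof. by move=> x y; apply: adele_eq => [|p] /=; rewrite rmorphB. Qed.
Lemma diag_is_monoid_morphism : monoid_morphism diag.
Proof.
split; first by apply: adele_eq => [|p] /=; rewrite rmorph1.
by move=> x y; apply: adele_eq => [|p] /=; rewrite rmorphM.
Qed.
HB.instance Definition _ :=
  GRing.isZmodMorphism.Build rat adele diag diag_is_zmod_morphism.
HB.instance Definition _ :=
  GRing.isMonoidMorphism.Build rat adele diag diag_is_monoid_morphism.

Record arakelov_divisor := ArakelovDivisor {
  div_fin : {fsfun prime_number -> int with 0};
  div_inf : R }.

Definition deg (D : arakelov_divisor) : R :=
  \sum_(p <- finsupp (div_fin D)) (div_fin D p)%:~R * ln (val p)%:R + div_inf D.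

Definition OD (D : arakelov_divisor) (p : prime_number) : set (Qp p) :=
  [set rat_Qp p ((val p)%:R ^ (- div_fin D p)) * z | z in Zpadic p].

End Adele.

Arguments OD [R] D p.

(* The object k_+ of Gamma^o is 'I_k.+1 with base point ord0; the element
   i : 'I_k of {1, ..., k} is lift ord0 i. *)
Record pmap (k l : nat) := PMap {
  pmap_fun :> 'I_k.+1 -> 'I_l.+1;
  pmap_base : pmap_fun ord0 = ord0 }.

Definition pmap_id k : pmap k k := @PMap k k id erefl.

Definition pmap_comp k l m (g : pmap l m) (f : pmap k l) : pmap k m :=
  @PMap k m (g \o f) (etrans (congr1 g (pmap_base f)) (pmap_base g)).

Record smodule := SModule {
  smod_ob :> nat -> choiceType;
  base : forall k, smod_ob k;
  smap : forall k l, pmap k l -> smod_ob k -> smod_ob l;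
  smap_base : forall k l (f : pmap k l), smap f (base k) = base l;
  smap_id : forall k (x : smod_ob k), smap (pmap_id k) x = x;
  smap_comp : forall k l m (g : pmap l m) (f : pmap k l) (x : smod_ob k),
    smap (pmap_comp g f) x = smap g (smap f x);
  smod_ob0 : forall x : smod_ob 0%N, x = base 0 }.

(* The group {1, -1} is bool with addb, where b stands for (-1) ^+ b. *)
Record spmodule := SPModule {
  spmod_smod :> smodule;
  act : bool -> forall k, spmod_smod k -> spmod_smod k;
  act1 : forall k (x : spmod_smod k), act false x = x;
  actM : forall b c k (x : spmod_smod k), act (b (+) c) x = act b (act c x);
  act_base : forall b k, act b (base spmod_smod k) = base spmod_smod k;
  act_smap : forall b k l (f : pmap k l) (x : spmod_smod k),
    act b (smap f x) = smap f (act b x) }.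

Record tolerant_module := TolerantModule {
  tol_spmod :> spmodule;
  tol : forall k, tol_spmod k -> tol_spmod k -> Prop;
  tol_refl : forall k (x : tol_spmod k), tol x x;
  tol_sym : forall k (x y : tol_spmod k), tol x y -> tol y x;
  tol_smap : forall k l (f : pmap k l) (x y : tol_spmod k),
    tol x y -> tol (smap f x) (smap f y);
  tol_act : forall b k (x y : tol_spmod k), tol x y -> tol (act b x) (act b y) }.

Definition diagonal_tolerance (E : spmodule) : tolerant_module.
Proof.
exists E (fun k x y => x = y) => [//|//|k l f x _ <- //|b k x _ <- //].
Defined.

Definition sigma k : pmap k 1 :=
  @PMap k 1 (fun i => if i == ord0 then ord0 else ord_max) erefl.

Lemma delta_base k (j : 'I_k) :
  (if ord0 == lift ord0 j then ord_max else ord0) = ord0 :> 'I_2.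
Proof. by []. Qed.

Definition delta k (j : 'I_k) : pmap k 1 :=
  @PMap k 1 (fun i => if i == lift ord0 j then ord_max else ord0) (delta_base j).

Section Dimension.
Variable E : tolerant_module.

(* x = \sum_j s_j, for s a finite sequence in E(1_+); for s empty, x is the
   base point because E(0_+) is a point. *)
Definition is_sum (x : E 1%N) (s : seq (E 1%N)) : Prop :=
  exists2 z : E (size s), smap (sigma (size s)) z = x &
    forall j : 'I_(size s), smap (delta j) z = nth (base E 1%N) s j.

Definition scale (a : int) (x : E 1%N) : E 1%N :=
  if a == 0 then base E 1%N else act (a < 0) x.

Definition generating (F : {fset E 1%N}) : Prop :=
  (forall x y, x \in F -> y \in F -> x <> y -> ~ tol x y) /\
  (forall x : E 1%N, exists (alpha : E 1%N -> int) (y : E 1%N),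
     [/\ forall f, f \in F -> alpha f \in [:: -1; 0; 1],
         is_sum y [seq scale (alpha f) f | f <- enum_fset F]
       & tol x y]).

(* n is the least cardinality of a generating set, which must exist. *)
Definition has_dim (n : nat) : Prop :=
  (exists2 F : {fset E 1%N}, generating F & #|` F|%fset = n) /\
  (forall F : {fset E 1%N}, generating F -> (n <= #|` F|%fset)%N).

End Dimension.

Section EilenbergMacLane.
Variable A : zmodType.

Definition HA_map k l (f : pmap k l) (x : 'rV[A]_k) : 'rV[A]_l :=
  \row_j \sum_(i < k | f (lift ord0 i) == lift ord0 j) x 0 i.

Definition HA_act (b : bool) k (x : 'rV[A]_k) : 'rV[A]_k := if b then - x else x.

Lemma HA_map_base k l (f : pmap k l) : HA_map f 0 = 0.
Proof. by apply/rowP => j; rewrite !mxE big1 // => i _; rewrite mxE. Qed.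

Lemma HA_map_id k (x : 'rV[A]_k) : HA_map (pmap_id k) x = x.
Proof.
apply/rowP => j; rewrite mxE (eq_bigl (pred1 j)) => [|i]; first exact: big_pred1_eq.
by rewrite (inj_eq lift_inj).
Qed.

Lemma HA_map_comp k l m (g : pmap l m) (f : pmap k l) (x : 'rV[A]_k) :
  HA_map (pmap_comp g f) x = HA_map g (HA_map f x).
Proof.
apply/rowP => j; rewrite !mxE.
under [RHS]eq_bigr do rewrite mxE.
rewrite (exchange_big_dep predT) //= big_mkcond /=; apply: eq_bigr => i _.
case: (unliftP ord0 (f (lift ord0 i))) => [h ->|->].
  rewrite (eq_bigl (fun t => (t == h) && (g (lift ord0 h) == lift ord0 j))).
    case: ifP => [_|_]; last by rewrite big_pred0 // => t; rewrite andbF.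
    by rewrite (eq_bigl (pred1 h)) ?big_pred1_eq // => t; rewrite andbT.
  move=> t; rewrite (inj_eq lift_inj) andbC [h == t]eq_sym.
  by case: eqVneq => [->|].
by rewrite pmap_base big_pred0 // => t; rewrite andbF.
Qed.

Lemma HA_ob0 (x : 'rV[A]_0) : x = 0. Proof. exact: thinmx0. Qed.

Definition HA_smod : smodule :=
  @SModule (fun k => 'rV[A]_k) (fun=> 0) HA_map HA_map_base HA_map_id
    HA_map_comp HA_ob0.

Lemma HA_act1 k (x : HA_smod k) : HA_act false x = x. Proof. by []. Qed.
Lemma HA_actM b c k (x : HA_smod k) :
  HA_act (b (+) c) x = HA_act b (HA_act c x).
Proof. by case: b c => [] [] //=; rewrite opprK. Qed.
Lemma HA_act_base b k : HA_act b (base HA_smod k) = base HA_smod k.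
Proof. by case: b => //=; rewrite oppr0. Qed.
Lemma HA_act_smap b k l (f : pmap k l) (x : HA_smod k) :
  HA_act b (smap f x) = smap f (HA_act b x : HA_smod k).
Proof.
case: b => //=; apply/rowP => j; rewrite !mxE -sumrN.
by apply: eq_bigr => i _; rewrite mxE.
Qed.

Definition HA : spmodule :=
  @SPModule HA_smod HA_act HA_act1 HA_actM HA_act_base HA_act_smap.

Lemma HA_mapB k l (f : pmap k l) (x y : 'rV[A]_k) :
  HA_map f (x - y) = HA_map f x - HA_map f y.
Proof.
apply/rowP => j; rewrite !mxE -sumrB.
by apply: eq_bigr => i _; rewrite !mxE.
Qed.

Lemma HA_mapD k l (f : pmap k l) (x y : 'rV[A]_k) :
  HA_map f (x + y) = HA_map f x + HA_map f y.
Proof.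
apply/rowP => j; rewrite !mxE -big_split.
by apply: eq_bigr => i _; rewrite !mxE.
Qed.

End EilenbergMacLane.

Lemma map_HA_map (A B : zmodType) (h : {additive A -> B}) k l (f : pmap k l)
  (x : 'rV[A]_k) : map_mx h (HA_map f x) = HA_map f (map_mx h x).
Proof.
apply/rowP => j; rewrite !mxE raddf_sum.
by apply: eq_bigr => i _; rewrite mxE.
Qed.

Section Submodule.
Variables (E : spmodule) (P : forall k, set (E k)).
Hypotheses (Pbase : forall k, P (base E k))
  (Psmap : forall k l (f : pmap k l) (x : E k), P x -> P (smap f x))
  (Pact : forall b k (x : E k), P x -> P (act b x)).

Definition sub_base k : @P k := exist _ (base E k) (mem_set (Pbase k)).
Definition sub_smap k l (f : pmap k l) (x : @P k) : @P l :=
  exist _ (smap f (val x)) (mem_set (Psmap f (set_mem (valP x)))).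
Definition sub_act b k (x : @P k) : @P k :=
  exist _ (act b (val x)) (mem_set (Pact b (set_mem (valP x)))).

Definition sub_smod : smodule.
Proof.
exists (fun k => @P k : choiceType) sub_base sub_smap.
- by move=> k l f; apply: val_inj; exact: smap_base.
- by move=> k x; apply: val_inj; exact: smap_id.
- by move=> k l m g f x; apply: val_inj; exact: smap_comp.
- by move=> x; apply: val_inj; exact: smod_ob0.
Defined.

Definition sub_spmod : spmodule.
Proof.
exists sub_smod sub_act.
- by move=> k x; apply: val_inj; exact: act1.
- by move=> b c k x; apply: val_inj; exact: actM.
- by move=> b k; apply: val_inj; exact: act_base.
- by move=> b k l f x; apply: val_inj; exact: act_smap.
Defined.

End Submodule.

Section Cohomology.
Variables (R : realType) (D : arakelov_divisor R).

Definition HOD k : set ('rV[adele R]_k) :=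
  [set b | (forall (i : 'I_k) (p : prime_number), OD D p (fin_part (b 0 i) p)) /\
           \sum_(i < k) `|arch (b 0 i)| <= expR (div_inf D)].
Arguments HOD : clear implicits.

Lemma OD0 p : OD D p 0.
Proof. by exists 0; [exact: Zp0|rewrite mulr0]. Qed.
Lemma ODN p x : OD D p x -> OD D p (- x).
Proof. by move=> [z hz <-]; exists (- z); [exact: ZpN|rewrite mulrN]. Qed.
Lemma ODD p x y : OD D p x -> OD D p y -> OD D p (x + y).
Proof.
by move=> [z hz <-] [t ht <-]; exists (z + t); [exact: ZpD|rewrite mulrDr].
Qed.

Lemma HOD_base k : HOD k 0.
Proof.
split=> [i p|]; first by rewrite mxE; exact: OD0.
by rewrite big1 ?expR_ge0 // => i _; rewrite mxE normr0.
Qed.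

Lemma HOD_act b k x : HOD k x -> HOD k (HA_act b x).
Proof.
case: b => // -[hf hi]; split=> [i p|]; first by rewrite mxE; exact: ODN.
by under eq_bigr do rewrite mxE raddfN normrN.
Qed.

Lemma HOD_smap k l (f : pmap k l) x : HOD k x -> HOD l (HA_map f x).
Proof.
move=> [hf hi]; split=> [j p|].
  rewrite mxE; elim/big_rec: _ => [|i y _]; first exact: OD0.
  exact: ODD.
apply: le_trans hi.
apply: (@le_trans _ _ (\sum_(j < l)
    \sum_(i < k | f (lift ord0 i) == lift ord0 j) `|arch (x 0 i)|)).
  by apply: ler_sum => j _; rewrite mxE raddf_sum; exact: ler_norm_sum.
rewrite (exchange_big_dep predT) //=; apply: ler_sum => i _.
case: (unliftP ord0 (f (lift ord0 i))) => [h ->|->]; last first.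
  by rewrite big_pred0.
rewrite (eq_bigl (pred1 h)) => [|t]; first by rewrite big_pred1_eq.
by rewrite (inj_eq lift_inj) eq_sym.
Qed.

Definition H0_set k : set ('rV[rat]_k) := [set q | HOD k (map_mx (@diag R) q)].
Arguments H0_set : clear implicits.

Lemma H0_base k : H0_set k 0.
Proof. by rewrite /H0_set /= map_mx0; exact: HOD_base. Qed.
Lemma H0_smap k l (f : pmap k l) q : H0_set k q -> H0_set l (HA_map f q).
Proof. by rewrite /H0_set /= map_HA_map; exact: HOD_smap. Qed.
Lemma H0_act b k q : H0_set k q -> H0_set k (HA_act b q).
Proof.
by case: b => //; rewrite /H0_set /= map_mxN; exact: (@HOD_act true).
Qed.

(* The kernel of (q, b) |-> q + b is carried by its first component. *)
Lemma H0_setE k (q : 'rV[rat]_k) :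
  H0_set k q <-> exists2 b, HOD k b & map_mx (@diag R) q + b = 0.
Proof.
split=> [hq|[b hb /eqP]].
  by exists (- map_mx (@diag R) q); [exact: (@HOD_act true)|exact: subrr].
by rewrite addr_eq0 /H0_set /= => /eqP ->; exact: (@HOD_act true).
Qed.

Definition H0 : tolerant_module :=
  diagonal_tolerance (@sub_spmod (HA rat) H0_set H0_base H0_smap H0_act).

Definition H1_tol k (x y : 'rV[adele R]_k) : Prop :=
  exists (q : 'rV[rat]_k) (b : 'rV[adele R]_k),
    HOD k b /\ x - y = map_mx (@diag R) q + b.

Definition H1 : tolerant_module.
Proof.
exists (HA (adele R)) H1_tol.
- move=> k x; exists 0, 0; split; first exact: HOD_base.
  by rewrite map_mx0 addr0 subrr.
- move=> k x y [q [b [hb e]]]; exists (- q), (- b).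
  by split; [exact: (@HOD_act true)|rewrite map_mxN -opprD -e opprB].
- move=> k l f x y [q [b [hb e]]]; exists (HA_map f q), (HA_map f b).
  by split; [exact: HOD_smap|rewrite /= -HA_mapB e HA_mapD map_HA_map].
- move=> [] k x y [q [b [hb e]]]; last by exists q, b.
  exists (- q), (- b).
  by split; [exact: (@HOD_act true)|rewrite /= map_mxN -!opprD e].
Defined.

End Cohomology.

Section RightHandSide.
Variable R : realType.

Definition log3 (x : R) : R := ln x / ln 3.

Definition deg3 (D : arakelov_divisor R) : R := deg D / ln 3.

Definition odd_ceil (x : R) : int :=
  if 0 <= x then Num.ceil x else - Num.ceil (- x).

Definition exceptional_set : set R :=
  \bigcup_(k in [set: nat]) `](log3 (3 ^+ k / 2)), (log3 ((3 ^+ k + 1) / 2))[%classic.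

End RightHandSide.

Arguments exceptional_set : clear implicits.

(* Main.v *)
Require Import Defs.
From HB Require Import structures.
From mathcomp Require Import all_boot all_order all_algebra.
From mathcomp Require Import finmap all_classical all_reals all_analysis.
From mathcomp Require Import ring lra zify.

Import Order.TTheory GRing.Theory Num.Theory.

Local Open Scope classical_set_scope.
Local Open Scope ring_scope.

(** The idea. Let r be the positive rational number with the same p-adic
    valuations as D, and lam = exp (deg D). Multiplication by r reduces everything
    to the case without finite part, with archimedean radius lam (OD_div_rat,
    expR_deg). With N the integral part of lam,

    - H^0(D)(1_+) becomes the set of integers of [-N, N], where a sum is defined
      when the absolute values of its terms add up to at most N (H0_setP);
    - H^1(D)(1_+) becomes, by strong approximation, the circle R/Z up to
      equivalence, two points being related when their distance is at most lam
      (strong_approximation, H1_tolP).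

    A set of k generators has at most 3^k signed sums. For H^0 they have to exhaust
    2 N + 1 integers, for H^1 the arcs of length 2 lam around them have to cover the
    circle; hence 3^k >= 2 N + 1, respectively 3^k >= 1 / (2 lam). Conversely, such k
    suffice, by balanced ternary: powers of 3, the last one adjusted so that the
    total is N, generate H^0 (H0_generating_ex); the points 3^i / 3^k generate H^1,
    and for the least k they are far enough apart (H1_generating_ex).

    So the dimension of H^0 is the least n0 with 2 N + 1 <= 3^n0 and that of H^1
    the least n1 with 1 <= 2 lam 3^n1. At most one of them is nonzero, and the
    comparison with the ceiling of log' (2 lam) = deg' D + log' 2 leads to the
    correction on L, where a power of 3 lies between 2 N + 1 and 2 lam
    (ternary_count_difference). The length of the k-th interval of L is at most
    3^-k / ln 3, so the total length is finite. *)

(** * Integrality of rational numbers at the primes *)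

(** A p-adic integer that is rational is congruent, up to a null sequence, to a
    rational of absolute value at most 1, and the ultrametric inequality passes
    the bound on. *)
Lemma Zpadic_rat (p : prime_number) (x : rat) :
  Zpadic p (rat_Qp p x) <-> padic_abs p x <= 1.
Proof.
split; last exact: Zp_rat.
move=> [u hu /eqP]; rewrite -Quotient.idealrBE => /asboolP /(_ 1 ltr01)[N hN].
rewrite -[x](subrK (u N)); apply: le_trans (padic_absD _ _ _) _.
by rewrite ge_max hu andbT ltW //; exact: (hN N (leqnn N)).
Qed.

Lemma padic_abs_le1 (p : prime_number) (x : rat) :
  (padic_abs p x <= 1) = ~~ (val p %| `|denq x|)%N.
Proof.
rewrite /padic_abs; case: ifP => [/eqP ->|x0].
  by rewrite ler01 dvdn1 gtn_eqF // prime_gt1 // (valP p).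
have cxd := coprime_num_den x.
rewrite -(expr0z (val p)%:R) ler_eXz2l ?prime_gt1q // oppr_le0 /padic_val subr_ge0.
rewrite lez_nat.
have pp := valP p.
have d0 : (0 < `|denq x|)%N by rewrite absz_gt0 denq_neq0.
have [pd|pd] := boolP (val p %| `|denq x|)%N; last first.
  by rewrite (logn_coprime (m := `|denq x|%N)) // prime_coprime.
apply/negbTE; rewrite -ltnNge (logn_coprime (m := `|numq x|%N)).
  by rewrite logn_gt0 mem_primes pp d0.
by rewrite coprime_sym; apply: coprime_dvdr pd cxd.
Qed.

(** A prime factor of the denominator is a place where x is not integral. *)
Lemma padic_integral_int (x : rat) :
  (forall p : prime_number, padic_abs p x <= 1) <-> exists n : int, x = n%:~R.
Proof.
split=> [h|[n -> p]]; last exact: padic_abs_int.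
exists (numq x); rewrite -[LHS]divq_num_den.
have [d1|d1] := leqP `|denq x|%N 1.
  have -> : denq x = 1; last by rewrite divr1.
  by have := denq_gt0 x; case: (denq x) d1 => // [[|[]]].
have := h (exist _ (pdiv `|denq x|) (pdiv_prime d1)).
by rewrite padic_abs_le1 /= pdiv_dvd.
Qed.

Lemma padic_absV (p : prime_number) (x : rat) :
  padic_abs p x^-1 = (padic_abs p x)^-1.
Proof.
have [->|x0] := eqVneq x 0; first by rewrite !(invr0, padic_abs0).
have ax0 : padic_abs p x != 0.
  by rewrite /padic_abs (negPf x0) expfz_neq0 // gt_eqF ?prime_gt0q.
by apply: (mulIf ax0); rewrite -padic_absM !mulVf // padic_abs1.
Qed.

Lemma padic_absX (p : prime_number) (x : rat) (n : int) :
  padic_abs p (x ^ n) = padic_abs p x ^ n.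
Proof.
have absX m : padic_abs p (x ^+ m) = padic_abs p x ^+ m.
  by elim: m => [|m IH]; rewrite ?expr0 ?padic_abs1 // !exprS padic_absM IH.
by case: n => n; rewrite ?NegzE -?exprnN -?exprnP ?padic_absV absX.
Qed.

Lemma padic_abs_other (p l : prime_number) : p != l -> padic_abs p (val l)%:R = 1.
Proof.
move=> pl; rewrite /padic_abs pnatr_eq0 gtn_eqF ?prime_gt0 ?(valP l) //.
rewrite /padic_val -[(val l)%:R]/((val l)%:Z%:~R) numq_int denq_int logn1 /=.
rewrite (@logn_prime (val p) _ (valP l)) (inj_eq val_inj) (negPf pl).
by [].
Qed.

(** * The rational number attached to a divisor *)

(** The positive rational number whose p-adic valuation is the coefficient of
    D at every p: the ideal class group of Z is trivial, so multiplication by it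
    turns O(D)_f into the product of all the Z_p, and the archimedean
    component is scaled accordingly. *)
Definition div_rat {R : realType} (D : arakelov_divisor R) : rat :=
  \prod_(p <- finsupp (div_fin D)) (val p)%:R ^ (div_fin D p).

Section DivRat.
Context {R : realType} (D : arakelov_divisor R).

Lemma div_rat_gt0 : 0 < div_rat D.
Proof. by apply: prodr_gt0 => p _; rewrite exprz_gt0 ?prime_gt0q. Qed.

Lemma padic_abs_div_rat p :
  padic_abs p (div_rat D) = padic_abs p ((val p)%:R ^ (div_fin D p)).
Proof.
rewrite /div_rat (big_morph _ (padic_absM p) (padic_abs1 p)).
have [pD|pD] := boolP (p \in finsupp (div_fin D)).
  rewrite (big_rem p) //= big_seq big1 ?mulr1 // => l.
  rewrite mem_rem_uniq ?fset_uniq // inE => /andP[lp _].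
  by rewrite padic_absX padic_abs_other 1?eq_sym // exp1rz.
rewrite fsfun_dflt // expr0z padic_abs1 big_seq big1 // => l lD.
rewrite padic_absX padic_abs_other ?exp1rz //.
by apply: contraNneq pD => ->.
Qed.

Lemma ln_div_rat : ln (ratr (div_rat D) : R) + div_inf D = deg D.
Proof.
congr (_ + _); rewrite /div_rat rmorph_prod /=.
have pos (l : prime_number) : 0 < (ratr ((val l)%:R ^ div_fin D l) : R).
  by rewrite ltr0q exprz_gt0 ?prime_gt0q.
move: (finsupp _ : {fset prime_number}) => S.
elim: (enum_fset S) => [|p s IH]; first by rewrite !big_nil ln1.
rewrite !big_cons lnM ?posrE ?pos //; last by apply: prodr_gt0 => l _; exact: pos.
rewrite IH; congr (_ + _).
rewrite fmorphXz /= ratr_nat.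
have p0 : 0 < (val p)%:R :> R by rewrite ltr0n prime_gt0 ?(valP p).
case: (div_fin D p) => n.
  by rewrite -exprnP lnXn // mulr_natl.
rewrite NegzE -exprnN lnV ?posrE ?exprn_gt0 // lnXn //.
by rewrite mulrNz mulNr mulr_natl.
Qed.

(** Rescaling by div_rat D turns the archimedean radius into exp (deg D): the
    degree is the only invariant of D left. *)
Lemma expR_deg : expR (deg D) = ratr (div_rat D) * expR (div_inf D).
Proof. by rewrite -ln_div_rat expRD lnK // posrE ltr0q div_rat_gt0. Qed.

(** The two scalars p^(a_p) and div_rat D differ by a p-adic unit. *)
Lemma OD_div_rat p x : OD D p x <-> Zpadic p (rat_Qp p (div_rat D) * x).
Proof.
pose a : rat := (val p)%:R ^ div_fin D p.
have p0 : (val p)%:R != 0 :> rat by rewrite gt_eqF ?prime_gt0q.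
have a0 : a != 0 by rewrite expfz_neq0.
have r0 : div_rat D != 0 by rewrite gt_eqF ?div_rat_gt0.
have aV : (val p)%:R ^ (- div_fin D p) = a^-1 by rewrite invr_expz.
have key y z : y != 0 -> padic_abs p y = padic_abs p z ->
    Zpadic p (rat_Qp p (z / y)).
  move=> y0 yz; apply: Zp_rat; rewrite padic_absM -yz -padic_absM divff //.
  by rewrite padic_abs1.
split=> [[z hz <-]|hx].
  rewrite aV mulrA -rmorphM; apply: ZpM => //.
  by apply: key => //; rewrite padic_abs_div_rat.
exists (rat_Qp p (a / div_rat D) * (rat_Qp p (div_rat D) * x)).
  apply: ZpM hx; apply: key => //; exact: padic_abs_div_rat.
by rewrite aV !mulrA -!rmorphM mulrA mulVf // mul1r mulVf // rmorph1 mul1r.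
Qed.

End DivRat.

(** * Strong approximation *)

(** A Cauchy sequence is eventually within distance 1 of one of its terms. *)
Lemma Qp_approx (p : prime_number) (x : Qp p) :
  exists q : rat, Zpadic p (x - rat_Qp p q).
Proof.
elim/quotW: x => u.
have [N hN] := asboolW (cauchy_valP u) 1 ltr01.
exists (u N).
have cw : padic_cauchy p (fun n => u (n + N)%N - u N).
  move=> e e0; have [M hM] := asboolW (cauchy_valP u) e e0.
  exists M => m n Mm Mn; rewrite opprB addrA subrK.
  by apply: hM; rewrite (leq_trans _ (leq_addr _ _)).
exists (PadicCauchySeq (asboolT cw)) => [n|].
  by apply: ltW; apply: hN; rewrite ?leq_addl.
rewrite /rat_Qp -rmorphB; apply/eqP; rewrite -Quotient.idealrBE.
apply/asboolP => e e0; have [M hM] := asboolW (cauchy_valP u) e e0.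
exists M => n Mn.
rewrite [X in padic_abs p X](_ : _ = u n - u (n + N)%N); last first.
  by rewrite -[LHS]/(u n - u N - (u (n + N)%N - u N)) opprB addrA subrK.
by apply: hM; rewrite // (leq_trans _ (leq_addr _ _)).
Qed.

(** One step of the partial fraction expansion: with denominator m p^k, m prime
    to p, a Bezout relation u m + v p^k = 1 splits the fraction into a p-integral
    part and a part whose denominator is a power of p. *)
Lemma rat_partial_fraction (p : prime_number) (x : rat) :
  exists q : rat, padic_abs p (x - q) <= 1 /\
    forall l : prime_number, l != p -> padic_abs l q <= 1.
Proof.
have pp := valP p.
have d0 : (0 < `|denq x|)%N by rewrite absz_gt0 denq_neq0.
have [m pm dE] := pfactor_coprime pp d0.
set k := logn _ _ in dE.
have [u [v uv]] := Bezoutz m%:Z (val p ^ k)%:Z.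
have {}uv : u%:~R * m%:R + v%:~R * (val p)%:R ^+ k = 1 :> rat.
  have /eqP c : coprimez m%:Z (val p ^ k)%N
    by rewrite coprimezE /= coprimeXr // coprime_sym.
  move: uv; rewrite c => /(congr1 (intr : int -> rat)).
  by rewrite rmorphD !rmorphM /= -natrX.
have p0 : (val p)%:R ^+ k != 0 :> rat by rewrite expf_neq0 // gt_eqF ?prime_gt0q.
have m0 : m%:R != 0 :> rat.
  by rewrite pnatr_eq0; apply: contraTneq d0 => m0; rewrite dE m0.
have xE : x = (numq x)%:~R / (m%:R * (val p)%:R ^+ k).
  rewrite -[LHS]divq_num_den; congr (_ / _).
  by rewrite -natrX -natrM -dE natr_absz gtr0_norm ?denq_gt0.
exists ((numq x * u)%:~R / (val p)%:R ^+ k); split=> [|l lp].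
  have -> : x - (numq x * u)%:~R / (val p)%:R ^+ k = (numq x * v)%:~R / m%:R.
    rewrite {1}xE !rmorphM /=; move: (_%:~R : rat) => N.
    have NE : N * (u%:~R * m%:R + v%:~R * (val p)%:R ^+ k) = N by rewrite uv mulr1.
    rewrite -[X in X / (m%:R * _)]NE.
    move: ((val p)%:R ^+ k) p0 {uv xE dE NE} => P P0.
    by field; rewrite P0 m0.
  rewrite padic_absM padic_absV [padic_abs p m%:R](_ : _ = 1).
    by rewrite invr1 mulr1 padic_abs_int.
  rewrite /padic_abs (negPf m0) /padic_val -[m%:R]/(m%:Z%:~R) numq_int denq_int logn1 /=.
  by rewrite logn_coprime.
rewrite padic_absM padic_absV.
have := padic_absX l (val p)%:R k; rewrite -exprnP => ->.
by rewrite padic_abs_other // exp1rz invr1 mulr1 padic_abs_int.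
Qed.

(** The finitely many non-integral places are treated one at a time: the
    rational number correcting the component at p has a power of p as its
    denominator, so the other places stay as they were. *)
Lemma strong_approximation (R : realType) (x : adele R) :
  exists q : rat, forall p, Zpadic p (fin_part x p - rat_Qp p q).
Proof.
have /finite_fsetP[s sE] := adele_integral x.
have [q hq] : exists q : rat, forall p,
    (p \in enum_fset s -> Zpadic p (fin_part x p - rat_Qp p q)) /\
    (p \notin enum_fset s -> padic_abs p q <= 1).
  elim: (enum_fset s) => [|p t [q hq]].
    by exists 0 => p; split=> // _; rewrite padic_abs0.
  have [pt|pt] := boolP (p \in t).
    exists q => l; rewrite inE; have [->|lp] := eqVneq l p; last exact: hq.
    by split=> // _; apply: (hq p).1.
  have [y hy] := Qp_approx p (fin_part x p).
  have [z [hz1 hz2]] := rat_partial_fraction p y.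
  exists (q + z) => l; rewrite inE; have [->|lp] := eqVneq l p; split=> //= lt.
  - rewrite -[fin_part x p](subrK (rat_Qp p y)) -addrA -rmorphB; apply: ZpD => //.
    apply: Zp_rat; rewrite [q + z]addrC opprD addrA; apply: le_trans (padic_absB _ _ _) _.
    by rewrite ge_max hz1 (hq p).2.
  - rewrite rmorphD opprD addrA; apply: ZpB; first exact: (hq l).1.
    by apply: Zp_rat; apply: hz2.
  - apply: le_trans (padic_absD _ _ _) _; rewrite ge_max (hq l).2 //=.
    exact: hz2.
exists q => p; have [ps|ps] := boolP (p \in enum_fset s); first exact: (hq p).1.
apply: ZpB; last by apply: Zp_rat; exact: (hq p).2.
apply: contrapT => px; move/negP: ps; apply.
by have : [set` s] p by rewrite -sE.
Qed.

(** * Signed sums and coverings of the circle *)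

(** Generalized balanced ternary. Adding w k to the weights replaces the
    interval [-s, s] of representable integers by its union with its
    translates by w k and - w k, and there is no gap between the three as long as
    w k <= 2 s + 1. The powers of 3 meet this bound exactly. *)
Lemma signed_sum_rep (w : nat -> int) (k : nat) :
  (forall i, (i < k)%N -> 0 <= w i <= 2 * (\sum_(j < i) w j) + 1) ->
  forall x : int, `|x| <= \sum_(i < k) w i ->
  exists2 a : nat -> int, (forall i, a i \in [:: -1; 0; 1]) &
    x = \sum_(i < k) a i * w i.
Proof.
elim: k => [|k IH] hw x.
  rewrite big_ord0 normr_le0 => /eqP ->.
  by exists (fun=> 0) => [i|]; rewrite ?inE // big_ord0.
have hk i : (i < k)%N -> 0 <= w i <= 2 * (\sum_(j < i) w j) + 1.
  by move=> ik; apply: hw; exact: ltnW.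
have /andP[w0 w1] := hw k (ltnSn k).
rewrite big_ord_recr /= => hx.
set s := \sum_(i < k) w i in w1 hx IH.
have step (c : int) : c \in [:: -1; 0; 1] -> `|x - c * w k| <= s ->
    exists2 a : nat -> int, (forall i, a i \in [:: -1; 0; 1]) &
      x = \sum_(i < k.+1) a i * w i.
  move=> hc /(IH hk)[a ha xE].
  exists (fun i => if i == k then c else a i) => [i|]; first by case: ifP.
  rewrite big_ord_recr /= eqxx -[LHS](subrK (c * w k)) xE; congr (_ + _).
  by apply: eq_bigr => i _; rewrite ltn_eqF.
have [xs|xs] := lerP `|x| s; first by apply: (step 0); rewrite ?inE //; lia.
have [x0|x0] := lerP 0 x; first by apply: (step 1); rewrite ?inE //; lia.
by apply: (step (-1)); rewrite ?inE //; lia.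
Qed.

Lemma sum_pow3 k : 2 * (\sum_(i < k) 3 ^+ i) + 1 = 3 ^+ k :> int.
Proof.
elim: k => [|k IH]; first by rewrite big_ord0 expr0.
by rewrite big_ord_recr /= exprS mulrDr addrAC IH; ring.
Qed.

(** Pigeonhole for generating sets with k elements: only 3^k signed sums are
    available. *)
Lemma card_signed_sums (A : zmodType) (I : finType) (h : I -> A) :
  exists2 s : seq A, size s = (3 ^ #|I|)%N &
    forall a : I -> int, (forall i, a i \in [:: -1; 0; 1]) ->
      \sum_i h i *~ a i \in s.
Proof.
exists [seq \sum_i h i *~ ((c i)%:Z - 1) | c : {ffun I -> 'I_3}].
  by rewrite size_image card_ffun card_ord.
move=> a ha; apply/mapP.
exists [ffun i => inord `|(a i + 1)%R|%N]; first by rewrite mem_enum.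
apply: eq_bigr => i _; rewrite ffunE.
by have := ha i; rewrite !inE => /or3P[] /eqP ->; rewrite inordK.
Qed.

(** If the circle R/Z, of length 1, is covered by arcs of length 2 lam, then
    there are at least 1 / (2 lam) of them. Instead of comparing measures one
    counts the M-th division points: an arc contains at most 2 lam M + 1 of
    them, and M tends to infinity. *)
Lemma circle_cover (R : realType) (s : seq R) (lam : R) :
  (forall t : R, exists2 u : R, u \in s & exists n : int, `|t - u - n%:~R| <= lam) ->
  1 <= 2 * lam * (size s)%:R.
Proof.
move=> cov.
have lam0 : 0 <= lam by have [u _ [n]] := cov 0; exact: le_trans.
suff count (M : nat) : (0 < M)%N ->
    M%:R <= (size s)%:R * (2 * lam * M%:R + 1) :> R.
  rewrite leNgt; apply/negP => lt1.
  pose d := 1 - 2 * lam * (size s)%:R.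
  have d0 : 0 < d by rewrite subr_gt0.
  have [M hM] : exists M : nat, (size s)%:R / d < M%:R.
    exists (Num.truncn ((size s)%:R / d)).+1; exact: truncnS_gt.
  have M0 : (0 < M)%N.
    by rewrite -(ltr0n R); apply: le_lt_trans hM; rewrite divr_ge0 // ltW.
  have := count M M0; move: hM; rewrite ltr_pdivrMr // /d; nra.
move=> M0; have M0R : 0 < M%:R :> R by rewrite ltr0n.
(* The integers i with i/M in the arc around u are consecutive: start u is the
   first of them, and there are at most L. *)
pose L := (Num.truncn (2 * lam * M%:R)).+1.
pose start (u : R) : int := Num.ceil (M%:R * (u - lam)).
pose res := [seq ((start u + j%:Z) %% M%:Z)%Z | u <- s, j <- iota 0 L].
have sz : (size [seq i%:Z | i <- iota 0 M] <= size res)%N.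
  apply: uniq_leq_size; first by rewrite map_inj_uniq ?iota_uniq // => i j [].
  move=> _ /mapP[i iM ->]; move: iM; rewrite mem_iota add0n => /= iM.
  have [u us [n hn]] := cov (i%:R / M%:R).
  pose j : int := i%:Z - n * M%:Z - start u.
  have hn' : `|i%:R - M%:R * u - n%:~R * M%:R| <= lam * M%:R.
    have -> : i%:R - M%:R * u - n%:~R * M%:R = (i%:R / M%:R - u - n%:~R) * M%:R.
      by field; rewrite gt_eqF.
    by rewrite normrM (gtr0_norm M0R) ler_wpM2r // ltW.
  have j0 : 0 <= j.
    rewrite subr_ge0 ceil_le_int rmorphB rmorphM /=.
    move: hn'; rewrite ler_norml => /andP[]; rewrite -!pmulrn; lra.
  have jL : j%:~R <= 2 * lam * M%:R.
    have := ceil_ge (M%:R * (u - lam)); rewrite -/(start u) !rmorphB rmorphM /=.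
    move: hn'; rewrite ler_norml => /andP[]; rewrite -!pmulrn; lra.
  apply/allpairsP; exists (u, `|j|%N); split; first exact: us.
    rewrite mem_iota leq0n add0n /L ltnS truncn_ge_nat ?mulr_ge0 ?ler0n //.
    by rewrite natr_absz ger0_norm.
  rewrite gez0_abs // addrC subrK -mulNr addrC modzMDl modz_small //.
move: sz; rewrite size_map size_iota size_allpairs size_iota => sz.
apply: le_trans (_ : (size s * L)%:R <= _); first by rewrite ler_nat.
rewrite natrM ler_wpM2l // /L -natr1 lerD2r.
by rewrite truncn_le // !mulr_ge0.
Qed.

(** Distinct points 3^i / 3^k and 3^j / 3^k of the circle are at distance at
    least 2 / 3^k: the difference of the numerators is at least 2 and at most a
    third of 3^k, so that it stays away from the other multiples of 3^k too. *)
Lemma pow3_gap (i j k : nat) (n : int) : (i < k)%N -> (j < k)%N -> i != j ->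
  2 <= `|3 ^+ i - 3 ^+ j - n * 3 ^+ k| :> int.
Proof.
wlog ij : i j n / (j < i)%N => [wl ik jk|ik jk _].
  rewrite neq_ltn => /orP[] ij; last by apply: wl; rewrite // gtn_eqF.
  have := wl j i (- n) ij jk ik; rewrite gtn_eqF // -normrN => /(_ isT).
  by congr (_ <= `|_|); ring.
have h1 : 3 * 3 ^+ j <= 3 ^+ i :> int by rewrite -exprS ler_eXn2l.
have h2 : 3 * 3 ^+ i <= 3 ^+ k :> int by rewrite -exprS ler_eXn2l.
have h3 : 1 <= 3 ^+ j :> int by rewrite exprn_ege1.
by case: (ltrgtP n 0) => [n0|n0|->]; nia.
Qed.

Lemma balanced_residue (z S : int) : 0 <= S ->
  exists x m : int, z = x + m * (2 * S + 1) /\ `|x| <= S.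
Proof.
move=> S0; exists (((z + S)%R %% (2 * S + 1)%R)%Z - S), ((z + S)%R %/ (2 * S + 1)%R)%Z.
have P0 : 2 * S + 1 != 0 by lia.
have := divz_eq (z + S) (2 * S + 1); have := modz_ge0 (z + S) P0.
have := ltz_mod (z + S) P0; lia.
Qed.

(** * Sums in Eilenberg-MacLane objects *)

Section HASums.
Context {A : zmodType}.

Lemma HA_sigmaE k (z : 'rV[A]_k) : HA_map (sigma k) z = const_mx (\sum_i z 0 i).
Proof. by apply/rowP => j; rewrite ord1 !mxE; apply: eq_bigl => i. Qed.

Lemma HA_deltaE k (j : 'I_k) (z : 'rV[A]_k) : HA_map (delta j) z = const_mx (z 0 j).
Proof.
apply/rowP => l; rewrite ord1 !mxE -[RHS](big_pred1_eq +%R j (fun i => z 0 i)).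
by apply: eq_bigl => i /=; rewrite (inj_eq lift_inj); case: (i == j).
Qed.

(** In an Eilenberg-MacLane object the components of z determine z, hence the
    abstract sum relation is the graph of the addition. *)
Lemma HA_sum_unique k (x : 'I_k -> 'rV[A]_1) (y : 'rV[A]_1) (z : 'rV[A]_k) :
  HA_map (sigma k) z = y -> (forall j, HA_map (delta j) z = x j) ->
  y = \sum_j x j.
Proof.
move=> <- hz; rewrite HA_sigmaE.
apply/rowP => j; rewrite mxE summxE; apply: eq_bigr => i _.
by rewrite -hz HA_deltaE mxE.
Qed.

Definition row_of {k} (x : 'I_k -> 'rV[A]_1) : 'rV[A]_k := \row_i x i 0 0.

Lemma row_of_sigma k (x : 'I_k -> 'rV[A]_1) :
  HA_map (sigma k) (row_of x) = \sum_j x j.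
Proof.
rewrite HA_sigmaE; apply/rowP => j; rewrite ord1 mxE summxE.
by apply: eq_bigr => i _; rewrite mxE.
Qed.

Lemma row_of_delta k (x : 'I_k -> 'rV[A]_1) (j : 'I_k) :
  HA_map (delta j) (row_of x) = x j.
Proof. by apply/rowP => l; rewrite HA_deltaE !mxE ord1. Qed.

End HASums.

Section Families.
Context {T : choiceType} {k : nat} (g : 'I_k -> T).
Hypothesis g_inj : injective g.

Lemma family_sum (A : nmodType) (phi : T -> A) :
  \sum_(x <- [fset g i | i in 'I_k]%fset) phi x = \sum_i phi (g i).
Proof. by rewrite big_imfset /= ?big_enum // => i j _ _; exact: g_inj. Qed.

Lemma family_card : #|` [fset g i | i in 'I_k]%fset| = k.
Proof. by rewrite card_imfset //= -cardE card_ord. Qed.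

(** The definition of a generating set takes coefficients indexed by the whole of
    E(1_+), while the constructions below number the generators. *)
Lemma family_extend (a : 'I_k -> int) : exists a' : T -> int, forall i, a' (g i) = a i.
Proof.
exists (fun x => if [pick i | g i == x] is Some i then a i else 0) => i.
by case: pickP => [j /eqP/g_inj ->//|/(_ i)]; rewrite eqxx.
Qed.

End Families.

(** * The dimension of H^0 *)

Section H0dim.
Context {R : realType} (D : arakelov_divisor R).
Let r := div_rat D.
Let lam := expR (deg D).

(** Over all primes together, integrality of r q at p means that r q is an
    integer; the archimedean bound is scaled by the same r. *)
Lemma H0_setP k (q : 'rV[rat]_k) : H0_set D q <->
  (forall i, exists n : int, r * q 0 i = n%:~R) /\
  ratr (\sum_i `|r * q 0 i|) <= lam.
Proof.
have r0 : 0 < r := div_rat_gt0 D.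
have -> : (ratr (\sum_i `|r * q 0 i|) <= lam) =
    (\sum_i `|arch (map_mx (diag R) q 0 i)| <= expR (div_inf D)).
  rewrite /lam expR_deg -[RHS](@ler_pM2l _ (ratr r)) ?ltr0q // rmorph_sum mulr_sumr.
  congr (_ <= _); apply: eq_bigr => i _; rewrite mxE /= normrM rmorphM /=.
  by rewrite gtr0_norm // ratr_norm.
split=> [[h1 h2]|[h1 h2]]; split=> // i.
  apply/padic_integral_int => p; rewrite -Zpadic_rat rmorphM /=.
  by have := h1 i p; rewrite mxE OD_div_rat.
move=> p; rewrite mxE OD_div_rat /= -rmorphM.
by apply: Zp_rat; move: p; apply/padic_integral_int.
Qed.

Definition h0val (x : H0 D 1%N) : 'rV[rat]_1 := val (x : (@H0_set R D 1%N : Type)).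

(** The coordinate identifying H^0(D)(1_+) with the integers of absolute value
    at most exp (deg D). *)
Definition h0int (x : H0 D 1%N) : int := numq (r * h0val x 0 0).

Lemma h0intE x : r * h0val x 0 0 = (h0int x)%:~R.
Proof.
have /H0_setP[/(_ 0)[n hn] _] := set_mem (valP (x : (@H0_set R D 1%N : Type))).
by rewrite /h0int /h0val hn numq_int.
Qed.

Lemma h0int_inj : injective h0int.
Proof.
move=> x y xy; apply: val_inj; apply/rowP => i; rewrite ord1.
have r0 : r != 0 by rewrite gt_eqF ?div_rat_gt0.
by apply: (mulfI r0); have := h0intE x; rewrite xy -h0intE.
Qed.

Let N := Num.truncn lam.

Lemma ratr_int_le (n : int) : (ratr (n%:~R : rat) <= lam) = (n <= N%:Z).
Proof.
rewrite ratr_int /N; have lam0 : 0 <= lam by exact: expR_ge0.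
case: n => n; last first.
  by rewrite NegzE; apply/esym/idP; rewrite ?(le_trans _ lam0) // lerz0.
by rewrite lez_nat truncn_ge_nat.
Qed.

Lemma h0int_onto (n : int) : `|n| <= N%:Z -> exists x, h0int x = n.
Proof.
move=> hn.
have r0 : r != 0 by rewrite gt_eqF ?div_rat_gt0.
have h : H0_set D (const_mx (n%:~R / r) : 'rV[rat]_1).
  apply/H0_setP; split=> [i|]; first by exists n; rewrite mxE mulrC divfK.
  by rewrite big_ord1 mxE mulrC divfK // -intr_norm ratr_int_le.
exists (exist (fun x => x \in @H0_set R D 1%N) _ (mem_set h) : H0 D 1%N).
by rewrite /h0int /h0val /= mxE mulrC divfK // numq_int.
Qed.

Lemma h0int_scale (a : int) (x : H0 D 1%N) : a \in [:: -1; 0; 1] ->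
  h0int (scale a x) = h0int x *~ a.
Proof.
move=> ha; apply: (@intr_inj rat); rewrite rmorphMz /= -!h0intE -mulrzr -mulrA mulrzr.
congr (_ * _).
by move: ha; rewrite !inE => /or3P[] /eqP ->; rewrite /scale /h0val /= ?mxE.
Qed.

Lemma H0_is_sum (y : H0 D 1%N) (s : seq (H0 D 1%N)) :
  is_sum y s -> h0int y = \sum_(x <- s) h0int x.
Proof.
rewrite (big_nth (base (H0 D) 1%N)) big_mkord => -[z hz1 hz2].
apply: (@intr_inj rat); rewrite rmorph_sum /= -h0intE.
rewrite (HA_sum_unique _ (fun j : 'I_(size s) => h0val (nth (base (H0 D) 1%N) s j))
  (h0val y) (val (z : (@H0_set R D (size s) : Type)))).
- by rewrite summxE mulr_sumr; apply: eq_bigr => i _; rewrite h0intE.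
- by rewrite -hz1.
- by move=> j; rewrite -hz2.
Qed.

(** Contrary to H^1(D), a sum in H^0(D) exists only under a bound on the sum of
    the absolute values of its terms; this bound is why the weights chosen below
    add up to N exactly. *)
Lemma H0_is_sum_ex (s : seq (H0 D 1%N)) : \sum_(x <- s) `|h0int x| <= N%:Z ->
  exists2 y, is_sum y s & h0int y = \sum_(x <- s) h0int x.
Proof.
move=> hs.
have [y hy] : exists y, h0int y = \sum_(x <- s) h0int x.
  by apply: h0int_onto; apply: le_trans hs; exact: ler_norm_sum.
exists y => //; move: hs hy; rewrite !(big_nth (base (H0 D) 1%N)) !big_mkord => hs hy.
pose x_ (j : 'I_(size s)) := nth (base (H0 D) 1%N) s j.
have h : H0_set D (row_of (fun j => h0val (x_ j))).
  apply/H0_setP; split=> [i|]; first by exists (h0int (x_ i)); rewrite mxE h0intE.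
  under eq_bigr => i _ do rewrite mxE h0intE -intr_norm.
  by rewrite -rmorph_sum ratr_int_le.
exists (exist (fun x => x \in @H0_set R D (size s)) _ (mem_set h) : H0 D (size s)).
  apply: val_inj; rewrite /= row_of_sigma; apply/rowP => i; rewrite ord1.
  have r0 : r != 0 by rewrite gt_eqF ?div_rat_gt0.
  apply: (mulfI r0); rewrite -/(h0val y) h0intE hy summxE mulr_sumr rmorph_sum.
  by apply: eq_bigr => j _; rewrite h0intE.
by move=> j; apply: val_inj; rewrite /= row_of_delta.
Qed.

(** The 2 N + 1 integers of [-N, N] must all be signed sums. *)
Lemma H0_generating_ge (F : {fset H0 D 1%N}) : generating F ->
  (2 * N + 1 <= 3 ^ #|` F|%fset)%N.
Proof.
move=> [_ gen].
have [s ssz hs] := card_signed_sums _ F (fun f => h0int (val f)).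
rewrite cardfE -ssz -[(2 * N + 1)%N](size_iota 0).
rewrite -(size_map (fun i : nat => i%:Z - N%:Z)).
apply: uniq_leq_size.
  by rewrite map_inj_uniq ?iota_uniq // => i j /addIr[].
move=> _ /mapP[i iN ->]; move: iN; rewrite mem_iota => iN.
have [|x <-] := h0int_onto (i%:Z - N%:Z); first by lia.
have [a [y [ha /H0_is_sum yE /= ->]]] := gen x.
rewrite yE big_map big_seq (eq_bigr (fun f => h0int f *~ a f)); last first.
  by move=> f fF; rewrite h0int_scale // ha.
rewrite -big_seq big_seq_fsetE /=.
by apply: hs => f; apply: ha; exact: valP.
Qed.

(** Integers of either sign are allowed as generators because only their
    absolute values matter; the sign is absorbed into the coefficient. *)
Lemma H0_generating_weights (k : nat) (w : nat -> int) :
  (forall i j, (i < k)%N -> (j < k)%N -> w i = w j -> i = j) ->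
  (forall i, (i < k)%N -> `|w i| <= 2 * (\sum_(j < i) `|w j|) + 1) ->
  \sum_(i < k) `|w i| = N%:Z ->
  exists2 F : {fset H0 D 1%N}, generating F & #|` F|%fset = k.
Proof.
move=> winj wstep wN.
have wle (i : 'I_k) : `|w i| <= N%:Z.
  by rewrite -wN (bigD1 i) //= ler_wpDr // sumr_ge0.
have [g gE] := choice (fun i : 'I_k => h0int_onto _ (wle i)).
have g_inj : injective g.
  move=> i j gij; apply/val_inj/(winj _ _ (ltn_ord i) (ltn_ord j)).
  by rewrite -!gE gij.
exists [fset g i | i in 'I_k]%fset; last exact: family_card.
split=> // x.
have xN : `|h0int x| <= \sum_(i < k) `|w i|.
  have /H0_setP[_] := set_mem (valP (x : (@H0_set R D 1%N : Type))).
  by rewrite big_ord1 -/(h0val x) h0intE -intr_norm ratr_int_le wN.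
have [|a ha xE] := signed_sum_rep (fun i => `|w i|) k _ _ xN.
  by move=> i ik; rewrite normr_ge0 wstep.
have [a' ha'] := family_extend _ g_inj (fun i => Num.sg (w i) * a i).
have sgP (i : nat) : Num.sg (w i) * a i \in [:: -1; 0; 1].
  have := ha i; rewrite !inE => /or3P[] /eqP ->; case: sgrP => _;
    by rewrite ?mulr0 ?mulr1 ?mulrN1 ?opprK.
have ha'F f : f \in [fset g i | i in 'I_k]%fset -> a' f \in [:: -1; 0; 1].
  by move=> /imfsetP[i _ ->]; rewrite ha'.
have sumE (A : nmodType) (phi : int -> A) :
    \sum_(y <- [seq scale (a' f) f | f <- [fset g i | i in 'I_k]%fset]) phi (h0int y) =
    \sum_(i < k) phi (a i * `|w i|).
  rewrite big_map big_seq (eq_bigr (fun f => phi (h0int f *~ a' f))); last first.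
    by move=> f fF; rewrite h0int_scale // ha'F.
  rewrite -big_seq (family_sum _ g_inj); apply: eq_bigr => i _.
  by rewrite gE ha' -mulrzr intz mulrA [w i * _]mulrC -normrEsg mulrC.
have [|y hy yE] := H0_is_sum_ex [seq scale (a' f) f | f <- [fset g i | i in 'I_k]%fset].
  rewrite sumE -wN; apply: ler_sum => i _; rewrite normrM normr_id.
  rewrite ler_piMl //.
  by have := ha i; rewrite !inE => /or3P[] /eqP ->.
exists a', y; split => //=; apply: h0int_inj.
by rewrite yE (sumE _ id).
Qed.

(** The powers 1, 3, ..., 3^(m-1) reach every integer up to S = (3^m - 1) / 2, and
    one more weight N - S brings the total to N. That weight may be one of the
    powers of 3, so it is taken with a minus sign to be a new element. *)
Lemma H0_generating_ex (k : nat) : (2 * N + 1 <= 3 ^ k)%N ->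
  (forall m, (m < k)%N -> (3 ^ m < 2 * N + 1)%N) ->
  exists2 F : {fset H0 D 1%N}, generating F & #|` F|%fset = k.
Proof.
case: k => [|m] hk hmin.
  apply: (H0_generating_weights 0 (fun=> 0)) => //.
  by rewrite big_ord0; move: hk; rewrite expn0; lia.
have S1 := sum_pow3 m; set S := \sum_(i < m) _ in S1.
have NS : S < N%:Z.
  have := hmin m (ltnSn m); rewrite -ltz_nat PoszD PoszM -natz natrX => h.
  by move: h; rewrite -S1; lia.
have N3 : 2 * N%:Z + 1 <= 3 * (2 * S + 1).
  by move: hk; rewrite -lez_nat PoszD PoszM -[X in _ <= X]natz natrX exprS -S1; lia.
pose w i : int := if (i < m)%N then 3 ^+ i else S - N%:Z.
have wS : \sum_(i < m) `|w i| = S.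
  by apply: eq_bigr => i _; rewrite /w ltn_ord ger0_norm // exprn_ge0.
apply: (H0_generating_weights m.+1 w) => [i j|i|].
- rewrite !ltnS /w => im jm; have p0 l : 0 < 3 ^+ l :> int by rewrite exprn_gt0.
  have := p0 i; have := p0 j.
  case: ltnP => [im'|mi]; case: ltnP => [jm'|mj]; try lia.
  by move=> _ _ e; apply/eqP; rewrite eqn_leq -!(@ler_eXn2l int 3) // e lexx.
- rewrite ltnS leq_eqVlt => /predU1P[->|im].
    by rewrite wS /w ltnn; lia.
  rewrite {1}/w im ger0_norm ?exprn_ge0 // -sum_pow3.
  rewrite (eq_bigr (fun j : 'I_i => `|w j|)) // => j _.
  by rewrite /w (ltn_trans (ltn_ord j)) // ger0_norm // exprn_ge0.
- by rewrite big_ord_recr /= wS /w ltnn; lia.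
Qed.

End H0dim.

(** * The dimension of H^1 *)

Section H1Circle.
Context {R : realType} (D : arakelov_divisor R).
Let r := div_rat D.
Let lam := expR (deg D).

(** By strong approximation the adeles modulo Q + O(D)_f form the circle
    R / r^-1 Z, which multiplication by r turns into R/Z; circle_rep x t says
    that the real number t represents the class of x there. *)
Definition circle_rep (x : adele R) (t : R) : Prop :=
  exists2 q : rat, forall p, Zpadic p (rat_Qp p r * fin_part x p - rat_Qp p q) &
    t = ratr r * arch x - ratr q.

Lemma circle_rep_ex x : exists t, circle_rep x t.
Proof.
have [q hq] := strong_approximation R (diag R r * x).
by exists (ratr r * arch x - ratr q), q.
Qed.

Lemma circle_rep_onto t : exists x, circle_rep x t.
Proof.
exists (Adele (t / ratr r) (@bad_cst _ Defs.Zp0)), 0 => [p|] /=.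
  by rewrite mulr0 rmorph0 subrr; exact: Defs.Zp0.
by rewrite rmorph0 subr0 mulrC divfK // gt_eqF // ltr0q div_rat_gt0.
Qed.

Lemma circle_rep0 : circle_rep 0 0.
Proof.
exists 0 => [p|] /=; last by rewrite mulr0 rmorph0 subrr.
by rewrite mulr0 rmorph0 subrr; exact: Defs.Zp0.
Qed.

Lemma circle_repB x y t u : circle_rep x t -> circle_rep y u -> circle_rep (x - y) (t - u).
Proof.
move=> [q hq ->] [q' hq' ->]; exists (q - q') => [p|] /=.
  rewrite mulrBr rmorphB opprB addrACA addrC.
  have := ZpB (hq p) (hq' p); congr (Zpadic p _).
  by rewrite !opprB; ring.
by rewrite rmorphB; ring.
Qed.

Lemma circle_repN x t : circle_rep x t -> circle_rep (- x) (- t).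
Proof. by rewrite -[- x]sub0r -[- t]sub0r; exact: circle_repB circle_rep0. Qed.

Lemma circle_repD x y t u : circle_rep x t -> circle_rep y u -> circle_rep (x + y) (t + u).
Proof. by move=> hx /circle_repN hy; rewrite -[y]opprK -[u]opprK; exact: circle_repB. Qed.

Lemma circle_repMz x t (n : int) : circle_rep x t -> circle_rep (x *~ n) (t *~ n).
Proof.
move=> h; elim/int_rect: n => [|n IH|n IH]; first by rewrite !mulr0z; exact: circle_rep0.
  by rewrite intS !mulrzDr; exact: circle_repD.
by rewrite intS opprD !mulrzDr; apply: circle_repD => //; exact: circle_repN.
Qed.

Lemma circle_rep_sum (I : Type) (s : seq I) (x : I -> adele R) (t : I -> R) :
  (forall i, circle_rep (x i) (t i)) -> circle_rep (\sum_(i <- s) x i) (\sum_(i <- s) t i).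
Proof.
move=> h; elim: s => [|i s IH]; first by rewrite !big_nil; exact: circle_rep0.
by rewrite !big_cons; exact: circle_repD.
Qed.

(** Representatives are unique up to integers. *)
Lemma circle_rep0_int t : circle_rep 0 t <-> exists n : int, t = n%:~R.
Proof.
split=> [[q hq ->]|[n ->]]; last first.
  exists (- n%:~R) => [p|] /=; last by rewrite mulr0 sub0r rmorphN /= opprK ratr_int.
  by rewrite mulr0 sub0r rmorphN opprK; apply: Zp_rat; exact: padic_abs_int.
have /padic_integral_int[n ->] : forall p, padic_abs p q <= 1.
  move=> p; have := ZpN (hq p); rewrite /= mulr0 sub0r opprK.
  by rewrite Zpadic_rat.
by exists (- n); rewrite /= mulr0 sub0r ratr_int rmorphN.
Qed.

(** In terms of the circle R/Z, the tolerance relation of H^1(D) is being at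
    distance at most exp (deg D). *)
Lemma H1_tolP (x y : 'rV[adele R]_1) (t : R) : circle_rep (x 0 0 - y 0 0) t ->
  H1_tol D x y <-> exists n : int, `|t - n%:~R| <= lam.
Proof.
have r0 : 0 < r := div_rat_gt0 D.
have r0R : 0 < ratr r :> R by rewrite ltr0q.
move=> ht; split=> [[q [b [[hb1 hb2] e]]]|[n hn]].
  have e0 : x 0 0 - y 0 0 = diag R (q 0 0) + b 0 0.
    by move/rowP: e => /(_ 0); rewrite !mxE.
  have hl : circle_rep (x 0 0 - y 0 0) (ratr r * arch (b 0 0)).
    exists (r * q 0 0) => [p|]; rewrite e0 /=.
      by rewrite mulrDr rmorphM addrAC subrr add0r -OD_div_rat.
    by rewrite rmorphM; ring.
  have /circle_rep0_int[n tn] : circle_rep 0 (t - ratr r * arch (b 0 0)).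
    by rewrite -(subrr (x 0 0 - y 0 0)); exact: circle_repB.
  exists n; rewrite -tn opprB addrC subrK normrM gtr0_norm //.
  by move: hb2; rewrite big_ord1 /lam expR_deg ler_pM2l.
have : circle_rep (x 0 0 - y 0 0) (t - n%:~R).
  by rewrite -[_ - y 0 0]subr0; apply: circle_repB ht _; apply/circle_rep0_int; exists n.
move=> [q hq tE]; exists (const_mx (q / r)), (x - y - const_mx (diag R (q / r))).
split; last by apply/rowP => i; rewrite !mxE [RHS]addrC subrK.
split=> [i p|].
  rewrite ord1 OD_div_rat !mxE /= mulrBr -rmorphM.
  by rewrite [_ * (q / _)]mulrC divfK ?gt_eqF.
rewrite big_ord1 !mxE /= -(ler_pM2l r0R) -expR_deg.
rewrite -[ratr r in X in X <= _]gtr0_norm // -normrM mulrBr.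
suff -> : ratr r * ratr (q / r) = ratr q :> R by rewrite -tE.
by rewrite -rmorphM /= mulrC divfK // gt_eqF.
Qed.

Lemma H1_scale (a : int) (x : 'rV[adele R]_1) : a \in [:: -1; 0; 1] ->
  scale a (x : H1 D 1) = x *~ a :> 'rV[adele R]_1.
Proof. by rewrite !inE => /or3P[] /eqP ->; rewrite /scale. Qed.

End H1Circle.

Section H1Dimension.
Context {R : realType} (D : arakelov_divisor R).
Let lam := expR (deg D).

Lemma H1_is_sum (y : 'rV[adele R]_1) (s : seq 'rV[adele R]_1) :
  @is_sum (H1 D) y s <-> y = \sum_(x <- s) x.
Proof.
rewrite (big_nth 0) big_mkord; split=> [[z]|->].
  exact: (HA_sum_unique _ (fun j : 'I_(size s) => nth 0 s j)).
exists (row_of (fun j : 'I_(size s) => nth 0 s j)); first exact: row_of_sigma.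
exact: row_of_delta.
Qed.

Lemma H1_signed_sum (y : 'rV[adele R]_1) (F : {fset H1 D 1%N}) (a : H1 D 1%N -> int) :
  (forall f, f \in F -> a f \in [:: -1; 0; 1]) ->
  is_sum (y : H1 D 1%N) [seq scale (a f) f | f <- enum_fset F] <->
    y = \sum_(f <- enum_fset F) (f : 'rV[adele R]_1) *~ a f.
Proof.
move=> ha; rewrite H1_is_sum big_map.
rewrite (@eq_big_seq 'rV[adele R]_1 _ _ _ (enum_fset F) _
  (fun f => (f : 'rV[adele R]_1) *~ a f)) // => f fF.
by apply: H1_scale; exact: ha.
Qed.

(** The arcs of radius lam around the signed sums cover the circle. *)
Lemma H1_generating_ge (F : {fset H1 D 1%N}) : generating F ->
  1 <= 2 * lam * (3 ^ #|` F|%fset)%:R.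
Proof.
move=> [_ gen].
have [th hth] := choice (fun x : 'rV[adele R]_1 => circle_rep_ex D (x 0 0)).
have [s ssz hs] := card_signed_sums R F (fun f => th (val f)).
rewrite cardfE -ssz; apply: circle_cover => t.
have [x hx] := circle_rep_onto D t.
have [a [y [ha /(H1_signed_sum y F a ha) yE txy]]] := gen (const_mx x : 'rV[adele R]_1).
exists (\sum_(f : F) th (val f) *~ a (val f)).
  by apply: hs => f; apply: ha; exact: valP.
move: txy => /= /H1_tolP; apply.
rewrite mxE; apply: circle_repB hx _.
rewrite yE summxE big_seq_fsetE /=.
apply: circle_rep_sum => f.
have -> : ((val f : 'rV[adele R]_1) *~ a (val f)) 0 0 =
    (val f : 'rV[adele R]_1) 0 0 *~ a (val f).
  by case: (a _) => n; rewrite ?NegzE ?mulrNz ?mxE -!pmulrn ?mulmxnE.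
by apply: circle_repMz; exact: hth.
Qed.

(** The points 3^i / 3^k, i < k, have as signed sums all multiples of 3^-k, by
    balanced ternary, and 3^-k is at most 2 lam. Minimality of k gives
    lam < (3/2) 3^-k, less than the distance of any two of the points, as a
    generating set requires. *)
Lemma H1_generating_ex (k : nat) : 1 <= 2 * lam * (3 ^ k)%:R ->
  (forall m, (m < k)%N -> 2 * lam * (3 ^ m)%:R < 1) ->
  exists2 F : {fset H1 D 1%N}, generating F & #|` F|%fset = k.
Proof.
move=> hk hmin.
pose P : R := 3 ^+ k; have P0 : 0 < P by rewrite exprn_gt0.
move: hk; rewrite natrX -/P => hk.
have [x hx] := choice (fun i : 'I_k => circle_rep_onto D (3 ^+ i / P)).
pose g (i : 'I_k) : H1 D 1%N := (const_mx (x i) : 'rV[adele R]_1).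
have gtol i j : tol (g i) (g j) -> i = j.
  move=> gij.
  have hl : circle_rep D ((g i : 'rV[adele R]_1) 0 0 - (g j : 'rV[adele R]_1) 0 0)
      (3 ^+ i / P - 3 ^+ j / P) by rewrite !mxE; apply: circle_repB (hx i) (hx j).
  have [n hn] := (H1_tolP D _ _ _ hl).1 gij.
  apply: contrapT => /eqP ij.
  have := pow3_gap i j k n (ltn_ord i) (ltn_ord j) ij.
  rewrite -(ler_int R) intr_norm !rmorphB rmorphM !rmorphXn /= -/P.
  have -> : 3 ^+ i - 3 ^+ j - n%:~R * P = (3 ^+ i / P - 3 ^+ j / P - n%:~R) * P.
    by field; rewrite gt_eqF.
  rewrite normrM (gtr0_norm P0) // => h2.
  have k0 : (0 < k)%N by apply: leq_ltn_trans (ltn_ord i).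
  have := hmin k.-1; rewrite ltn_predL => /(_ k0).
  have : lam * P = 3 * (lam * (3 ^ k.-1)%:R).
    by rewrite mulrCA natrX -exprS prednK.
  have : `|3 ^+ i / P - 3 ^+ j / P - n%:~R| * P <= lam * P by rewrite ler_wpM2r // ltW.
  lra.
have g_inj : injective g by move=> i j gij; apply: gtol; rewrite gij; exact: tol_refl.
exists [fset g i | i in 'I_k]%fset; last exact: family_card.
split=> [y z /imfsetP[i _ ->] /imfsetP[j _ ->] ij /gtol ij'|y].
  by apply: ij; rewrite ij'.
have [t ht] := circle_rep_ex D ((y : 'rV[adele R]_1) 0 0).
(* z / P is the multiple of 1 / P nearest to t, and c its centred residue. *)
pose z := Num.floor (P * t + 2^-1).
have S0 : 0 <= \sum_(i < k) (3 ^+ i : int) by rewrite sumr_ge0 // => i _; rewrite exprn_ge0.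
have [c [m [zE cS]]] := balanced_residue z _ S0.
rewrite sum_pow3 in zE.
have [||a ha cE] := signed_sum_rep (fun i => 3 ^+ i) k _ c.
- by move=> i _; rewrite exprn_ge0 //= sum_pow3.
- exact: cS.
have [a' ha'] := family_extend _ g_inj (fun i => a i).
have ha'F f : f \in [fset g i | i in 'I_k]%fset -> a' f \in [:: -1; 0; 1].
  by move=> /imfsetP[i _ ->]; rewrite ha'.
exists a', (\sum_(f <- [fset g i | i in 'I_k]%fset) (f : 'rV[adele R]_1) *~ a' f).
split => //; first by apply/H1_signed_sum.
apply/(H1_tolP D _ _ (t - c%:~R / P)).
  apply: circle_repB ht _; rewrite (family_sum _ g_inj) summxE cE rmorph_sum mulr_suml /=.
  apply: circle_rep_sum => i.
  have -> : (const_mx (x i) *~ a' (g i) : 'rV[adele R]_1) 0 0 = x i *~ a i.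
    by rewrite ha'; case: (a _) => n; rewrite ?NegzE ?mulrNz ?mxE -!pmulrn ?mulmxnE ?mxE.
  rewrite rmorphM rmorphXn /= -mulrA mulrzl.
  exact: circle_repMz.
exists m.
have : `|P * t - z%:~R| <= 2^-1.
  have := floor_le (P * t + 2^-1); have := lt_succ_floor (P * t + 2^-1).
  rewrite -/z => h1 h2; rewrite ler_norml; lra.
have -> : P * t - z%:~R = (t - c%:~R / P - m%:~R) * P.
  by rewrite zE rmorphD rmorphM rmorphXn /= -/P; field; rewrite gt_eqF.
rewrite normrM (gtr0_norm P0) // -ler_pdivlMr // => h; apply: le_trans h _.
rewrite ler_pdivrMr // -/lam; lra.
Qed.

End H1Dimension.

(** * Logarithms to base 3 and the exceptional set *)

Section Log3.
Context {R : realType}.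
Implicit Types x y : R.

Lemma ln3_gt0 : 0 < ln 3 :> R.
Proof. by rewrite ln_gt0 // ltr1n. Qed.

Lemma log3_lt x y : 0 < x -> 0 < y -> (log3 x < log3 y) = (x < y).
Proof. by move=> x0 y0; rewrite /log3 ltr_pM2r ?invr_gt0 ?ln3_gt0 // ltr_ln. Qed.

Lemma log3_le x y : 0 < x -> 0 < y -> (log3 x <= log3 y) = (x <= y).
Proof. by move=> x0 y0; rewrite !leNgt log3_lt. Qed.

Lemma log3_1 : log3 1 = 0 :> R.
Proof. by rewrite /log3 ln1 mul0r. Qed.

Lemma log3_pow n : log3 (3 ^+ n) = n%:R :> R.
Proof. by rewrite /log3 lnXn // -[ln 3 *+ n]mulr_natl mulfK // gt_eqF ?ln3_gt0. Qed.

Lemma ceil_log3 x n : 1 <= x -> x <= 3 ^+ n ->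
  (forall m, (m < n)%N -> 3 ^+ m < x) -> Num.ceil (log3 x) = n%:Z.
Proof.
move=> x1 xn hn; have x0 : 0 < x by apply: lt_le_trans x1.
apply: ceil_def; apply/andP; split; last first.
  by rewrite -[n%:~R](log3_pow n) log3_le // exprn_gt0.
case: n hn xn => [|m] hn _.
  rewrite sub0r; apply: (@lt_le_trans _ _ 0); first by rewrite rmorphN ltrN10.
  by rewrite -log3_1 log3_le.
by rewrite intS addrC addKr -[m%:~R](log3_pow m) log3_lt ?hn // exprn_gt0.
Qed.

(** With lam = exp (deg D), the exceptional set asks for 2 lam strictly between
    3^k and 3^k + 1. *)
Lemma exceptional_log3P (lam : R) : 0 < lam ->
  exceptional_set R (log3 lam) <->
  exists k : nat, 3 ^+ k < 2 * lam /\ 2 * lam < 3 ^+ k + 1.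
Proof.
move=> lam0.
have P0 k : 0 < 3 ^+ k :> R by rewrite exprn_gt0.
have E k : (log3 lam \in `](log3 (3 ^+ k / 2)), (log3 ((3 ^+ k + 1) / 2))[) =
    (3 ^+ k < 2 * lam) && (2 * lam < 3 ^+ k + 1).
  have Pk := P0 k; rewrite in_itv /= !log3_lt ?divr_gt0 ?addr_gt0 //.
  by rewrite ltr_pdivrMr // ltr_pdivlMr // mulrC.
split=> [[k _ /=]|[k [h1 h2]]]; first by rewrite E => /andP[]; exists k.
by exists k; rewrite //= E h1.
Qed.

(** The k-th interval has length log' (1 + 3^-k) and ln (1 + u) <= u. *)
Lemma exceptional_length (k : nat) :
  log3 ((3 ^+ k + 1) / 2) - log3 (3 ^+ k / 2) <= 3 ^- k / ln 3 :> R.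
Proof.
have P0 : 0 < 3 ^+ k :> R by rewrite exprn_gt0.
rewrite /log3 -mulrBl ler_pM2r ?invr_gt0 ?ln3_gt0 //.
rewrite -lnV ?posrE ?divr_gt0 // -lnM ?posrE ?invr_gt0 ?divr_gt0 ?addr_gt0 //.
have -> : (3 ^+ k + 1) / 2 * (3 ^+ k / 2)^-1 = 1 + 3 ^- k :> R.
  by field; rewrite gt_eqF.
by apply: le_ln1Dx; apply: lt_trans (_ : 0 < _); rewrite ?ltrN10 // invr_gt0.
Qed.

Lemma exceptional_measure : (lebesgue_measure (exceptional_set R) < +oo)%E.
Proof.
have mI k : measurable (`](log3 (3 ^+ k / 2)), (log3 ((3 ^+ k + 1) / 2))[%classic : set R).
  exact: measurable_itv.
apply: (@le_lt_trans _ _ (3 / 2 / ln 3)%:E); last exact: ltry.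
apply: le_trans.
  apply: (@measure_sigma_subadditive _ _ _ (@lebesgue_measure R) _
    (fun k => `](log3 (3 ^+ k / 2)), (log3 ((3 ^+ k + 1) / 2))[%classic)) => //.
  exact: bigcup_measurable.
apply: lime_le; first exact: is_cvg_nneseries.
apply: nearW => n.
apply: (@le_trans _ _ (\sum_(0 <= k < n) (3 ^- k / ln 3)%:E)%E).
  apply: lee_sum => k _.
  rewrite [X in (X <= _)%E](lebesgue_measure_itv
    `](log3 (3 ^+ k / 2)), (log3 ((3 ^+ k + 1) / 2))[) /=.
  case: ifP => _; first by rewrite -EFinB lee_fin exceptional_length.
  by rewrite lee_fin divr_ge0 ?invr_ge0 ?exprn_ge0 // ltW // ln3_gt0.
rewrite sumEFin lee_fin -mulr_suml ler_pM2r ?invr_gt0 ?ln3_gt0 //.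
suff -> : \sum_(0 <= k < n) 3 ^- k = 3 / 2 - 3 ^- n * (3 / 2) :> R.
  by rewrite gerBl mulr_ge0 // invr_ge0 exprn_ge0.
elim: n => [|n IH]; first by rewrite big_nil expr0 invr1 mul1r subrr.
by rewrite big_nat_recr //= IH exprS; field; rewrite expf_neq0.
Qed.

(** The count for H^0 involves 2 N + 1 with N the integral part of lam, the ceiling
    involves 2 lam. As the powers of 3 are odd, 3^k lies in [2 N + 1, 2 lam) if
    and only if 3^k < 2 lam < 3^k + 1: this is the exceptional case, where n0 is
    one less than the ceiling. If 2 lam < 1 then n0 = 0 and n1 is the ceiling of
    - log' (2 lam), which the odd ceiling takes into account. *)
Lemma ternary_count_difference (lam : R) (n0 n1 : nat) :
  let N := Num.truncn lam in 0 < lam ->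
  (2 * N + 1 <= 3 ^ n0)%N ->
  (forall m, (2 * N + 1 <= 3 ^ m)%N -> (n0 <= m)%N) ->
  1 <= 2 * lam * (3 ^ n1)%:R ->
  (forall m, 1 <= 2 * lam * (3 ^ m)%:R -> (n1 <= m)%N) ->
  n0%:R - n1%:R = (odd_ceil (log3 (2 * lam)))%:~R
                  - \1_(exceptional_set R) (log3 lam) :> R.
Proof.
move=> N lam0 h0 min0 h1 min1.
have lt0 m : (m < n0)%N -> (3 ^ m < 2 * N + 1)%N.
  by rewrite ltnNge => mn; rewrite ltnNge; apply: contra mn; exact: min0.
have lt1 m : (m < n1)%N -> 2 * lam * (3 ^ m)%:R < 1.
  by rewrite ltnNge => mn; rewrite ltNge; apply: contra mn; exact: min1.
rewrite /odd_ceil.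
have Nle : N%:R <= lam by rewrite truncn_le // ltW.
have Ngt : lam < N%:R + 1 by rewrite natr1 truncnS_gt.
have odd3 k : odd (3 ^ k)%N by rewrite oddX orbT.
have ind (b : bool) : (exceptional_set R (log3 lam) <-> b) ->
    \1_(exceptional_set R) (log3 lam) = b%:R :> R.
  by rewrite indicE => h; congr (_%:R); congr nat_of_bool;
    apply/idP/idP => [/set_mem/h|/h/mem_set].
have [lam2|lam2] := lerP 1 (2 * lam).
  have n10 : n1 = 0%N by apply/eqP; rewrite -leqn0; apply: min1; rewrite expn0 mulr1.
  have -> : 0 <= log3 (2 * lam) by rewrite -log3_1 log3_le // mulr_gt0.
  rewrite n10 subr0 (ind (3 ^+ n0 < 2 * lam)).
    have [gt|le] := ltrP (3 ^+ n0) (2 * lam).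
      rewrite (ceil_log3 (2 * lam) n0.+1) //.
      - by rewrite -pmulrn -natr1 addrK.
      - have : (2 * N + 1)%:R <= (3 ^ n0)%:R :> R by rewrite ler_nat.
        have : 1 <= 3 ^+ n0 :> R by rewrite exprn_ege1 // ler1n.
        rewrite natrD natrM natrX exprS; lra.
      - move=> m; rewrite ltnS => mn; apply: le_lt_trans gt.
        by rewrite ler_eXn2l // ltr1n.
    rewrite (ceil_log3 (2 * lam) n0) // ?subr0 //.
    move=> m /lt0; rewrite addn1 ltnS leq_eqVlt => /predU1P[e|].
      by have := odd3 m; rewrite e oddM.
    by rewrite -(ltr_nat R) natrX natrM; lra.
  rewrite exceptional_log3P //; split=> [[k [k1 k2]]|gt].
    apply: le_lt_trans k1; rewrite ler_eXn2l ?ltr1n //; apply: min0.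
    have : (2 * N < 3 ^ k + 1)%N by rewrite -(ltr_nat R) natrD natrM natrX; lra.
    rewrite addn1 ltnS leq_eqVlt => /predU1P[e|]; last by rewrite addn1.
    by have := odd3 k; rewrite -e oddM.
  exists n0; split=> //.
  have : (2 * N + 1)%:R <= (3 ^ n0)%:R :> R by rewrite ler_nat.
  rewrite natrD natrM natrX; lra.
have N0 : N = 0%N.
  by apply/eqP; rewrite -leqn0 -ltnS -(ltr_nat R); move: Nle; lra.
have n00 : n0 = 0%N by apply/eqP; rewrite -leqn0; apply: min0; rewrite N0.
have -> : (0 <= log3 (2 * lam)) = false.
  by apply/negbTE; rewrite -ltNge -log3_1 log3_lt // mulr_gt0.
rewrite (ind false) ?subr0; last first.
  rewrite exceptional_log3P //; split=> // -[k [k1 _]].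
  have : 1 <= 3 ^+ k :> R by rewrite exprn_ege1 // ler1n.
  lra.
have -> : - log3 (2 * lam) = log3 (2 * lam)^-1.
  by rewrite /log3 lnV ?posrE ?mulr_gt0 // mulNr.
have x0 : 0 < 2 * lam by rewrite mulr_gt0.
rewrite (ceil_log3 _ n1) ?n00 ?sub0r ?rmorphN //.
- by rewrite invf_ge1 // ltW.
- by rewrite -natrX -[X in X <= _]mul1r ler_pdivrMr // mulrC.
- by move=> m /lt1; rewrite natrX -[X in _ -> _ < X]mul1r ltr_pdivlMr // mulrC.
Qed.

End Log3.

(** * The Riemann-Roch formula *)

Theorem theorem1p1 (R : realType) (D : arakelov_divisor R) :
  (lebesgue_measure (exceptional_set R) < +oo)%E /\
  exists n0 n1 : nat,
    [/\ has_dim (H0 D) n0,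
        has_dim (H1 D) n1
      & n0%:R - n1%:R =
          (odd_ceil (deg3 D + log3 2))%:~R
          - \1_(exceptional_set R) (deg3 D) :> R].
Proof.
split; first exact: exceptional_measure.
pose lam : R := expR (deg D); pose N := Num.truncn lam.
have lam0 : 0 < lam by exact: expR_gt0.
have degE : deg3 D = log3 lam by rewrite /log3 expRK.
have xE : deg3 D + log3 2 = log3 (2 * lam).
  by rewrite degE /log3 lnM ?posrE // mulrDl addrC.
have ex0 : exists k, (2 * N + 1 <= 3 ^ k)%N.
  by exists (2 * N + 1)%N; apply/ltnW/ltn_expl.
have ex1 : exists k, 1 <= 2 * lam * (3 ^ k)%:R.
  exists (Num.truncn (2 * lam)^-1).+1.
  rewrite mulrC -ler_pdivrMr ?mulr_gt0 // mul1r; apply/ltW/(lt_le_trans (truncnS_gt _)).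
  by rewrite ler_nat ltnW // ltn_expl.
case: (ex_minnP ex0) => n0 h0 min0; case: (ex_minnP ex1) => n1 h1 min1.
have lt0 m : (m < n0)%N -> (3 ^ m < 2 * N + 1)%N.
  by rewrite ltnNge => mn; rewrite ltnNge; apply: contra mn; exact: min0.
have lt1 m : (m < n1)%N -> 2 * lam * (3 ^ m)%:R < 1.
  by rewrite ltnNge => mn; rewrite ltNge; apply: contra mn; exact: min1.
exists n0, n1; split.
- split; first exact: H0_generating_ex.
  by move=> F /H0_generating_ge; exact: min0.
- split; first exact: H1_generating_ex.
  by move=> F /H1_generating_ge; exact: min1.
rewrite xE degE; exact: ternary_count_difference.
Qed.
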